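(* Under the bivariate normal model with parameters $(\mu_1,\mu_2,\beta,\theta,\eta)$ and prior $\pi(\mu_1,\mu_2,\beta,\theta,\eta)\propto(\theta\eta)^{-1}$, the prior $\pi$ is a highest posterior density (HPD) matching prior for each of $\beta$, $\theta$ and $\eta$ individually. That is, for each choice of interest parameter $\psi\in\{\beta,\theta,\eta\}$ and each $\alpha\in(0,1)$, let $H_{\psi,\alpha}(X)=\{\psi:\pi(\psi\mid X)\ge k\}$, where $\pi(\psi\mid X)$ is the marginal posterior density of $\psi$ under $\pi$ and $k=k_{\psi,\alpha}(X)$ is chosen so that $H_{\psi,\alpha}(X)$ has posterior probability $1-\alpha$. Then for each fixed value $\omega=(\mu_1,\mu_2,\beta,\theta,\eta)$ of the parameter, as $n\to\infty$, $$P_\omega\{\psi\in H_{\psi,\alpha}(X)\}=1-\alpha+o(n^{-1}).$$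
   Context: Data: $X=\{(X_{1i},X_{2i}):i=1,\dots,n\}$ ($n\ge 3$) are i.i.d. bivariate normal with means $\mu_1,\mu_2$, variances $\sigma_1^2,\sigma_2^2>0$ and correlation $\rho$, $|\rho|<1$. Reparameterize by $$\beta=\rho\sigma_2/\sigma_1,\qquad \theta=\sigma_1\sigma_2(1-\rho^2)^{1/2},\qquad \eta=\sigma_2(1-\rho^2)^{1/2}/\sigma_1,$$ so that $(\mu_1,\mu_2,\beta,\theta,\eta)$ ranges over $\mathbb{R}^3\times(0,\infty)^2$, and the density of one observation is $$f(x_1,x_2)=(2\pi\theta)^{-1}\exp\Big\{-\tfrac12\Big[\frac{(x_2-\mu_2-\beta(x_1-\mu_1))^2}{\theta\eta}+\frac{\eta(x_1-\mu_1)^2}{\theta}\Big]\Big\}$$ (in this display only, $\pi$ is the usual constant). The improper prior $\pi\propto(\theta\eta)^{-1}$ is a density with respect to Lebesgue measure $d\mu_1\,d\mu_2\,d\beta\,d\theta\,d\eta$; the posterior is obtained by normalizing likelihood times prior, and the marginal posterior density of $\psi$ is its density with respect to Lebesgue measure $d\psi$. $P_\omega$ denotes the sampling probability of the data when the true parameter is $\omega$; $\psi$ inside $P_\omega$ is the corresponding component of $\omega$. *)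

(* Defs.v *)
From HB Require Import structures.
From mathcomp Require Import all_boot all_order all_algebra.
From mathcomp Require Import all_classical all_reals all_analysis.
Set Implicit Arguments.
Unset Strict Implicit.
Unset Printing Implicit Defensive.
Import Order.TTheory GRing.Theory Num.Theory.
Import numFieldTopology.Exports numFieldNormedType.Exports.
Local Open Scope classical_set_scope.
Local Open Scope ring_scope.

Record param (R : realType) := Param {
  p_mu1 : R;
  p_mu2 : R;
  p_beta : R;
  p_theta : R;
  p_eta : R }.

Definition valid_param (R : realType) (w : param R) : Prop :=
  0 < p_theta w /\ 0 < p_eta w.

(* With sigma_1^2, sigma_2^2 the variances and rho the correlation,
     beta  = rho * sigma_2 / sigma_1,
     theta = sigma_1 * sigma_2 * sqrt (1 - rho^2),
     eta   = sigma_2 * sqrt (1 - rho^2) / sigma_1,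
   so theta * eta is the conditional variance of the second coordinate given
   the first one, and theta / eta is the variance of the first coordinate. *)
Definition bvn_density (R : realType) (w : param R) (z : R * R) : R :=
  (2 * pi * p_theta w)^-1 *
  expR (- 2^-1 *
    ((z.2 - p_mu2 w - p_beta w * (z.1 - p_mu1 w)) ^+ 2 / (p_theta w * p_eta w)
     + p_eta w * (z.1 - p_mu1 w) ^+ 2 / p_theta w)).

Definition iid_density (R : realType) (d : measure_display)
    (T : measurableType d) (P : probability T R) (n : nat)
    (X : 'I_n -> T -> R * R) (f : R * R -> R) : Prop :=
  [/\ forall i, measurable_fun setT (X i),
      forall i (A : set (R * R)), measurable A ->
        P (X i @^-1` A) =
        (\int[(@lebesgue_measure R \x @lebesgue_measure R)%E]_(z in A)
           (f z)%:E)%E &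
      (* taking some of the A i equal to setT yields the product rule for
         every subfamily *)
      forall A : 'I_n -> set (R * R), (forall i, measurable (A i)) ->
        P (\bigcap_(i in [set: 'I_n]) (X i @^-1` A i)) =
        (\prod_(i < n) P (X i @^-1` A i))%E].

Definition likelihood (R : realType) (n : nat) (x : 'I_n -> R * R)
    (w : param R) : R := \prod_(i < n) bvn_density w (x i).

(* Iterated integrals of a nonnegative function, so the order is immaterial. *)
Definition evidence (R : realType) (prior : param R -> R) (n : nat)
    (x : 'I_n -> R * R) : \bar R :=
  (\int[@lebesgue_measure R]_(m1 in setT)
   \int[@lebesgue_measure R]_(m2 in setT)
   \int[@lebesgue_measure R]_(b in setT)
   \int[@lebesgue_measure R]_(t in `]0%R, +oo[)
   \int[@lebesgue_measure R]_(e in `]0%R, +oo[)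
     (likelihood x (Param m1 m2 b t e) * prior (Param m1 m2 b t e))%:E)%E.

Definition proper_posterior (R : realType) (prior : param R -> R) (n : nat)
    (x : 'I_n -> R * R) : Prop :=
  (0 < evidence prior x)%E /\ (evidence prior x < +oo)%E.

(* meaningful only when [proper_posterior prior x] *)
Definition posterior_density (R : realType) (prior : param R -> R) (n : nat)
    (x : 'I_n -> R * R) (w : param R) : R :=
  likelihood x w * prior w / fine (evidence prior x).

Variant interest := Beta | Theta | Eta.

Definition interest_val (R : realType) (psi : interest) (w : param R) : R :=
  match psi with
  | Beta => p_beta w
  | Theta => p_theta w
  | Eta => p_eta w
  end.

(* the values of [psi] over the parameter space *)
Definition interest_range (R : realType) (psi : interest) : set R :=
  match psi with
  | Beta => setT
  | Theta | Eta => `]0%R, +oo[%classic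
  end.

Definition marginal_density (R : realType) (psi : interest)
    (prior : param R -> R) (n : nat) (x : 'I_n -> R * R) (v : R) : \bar R :=
  match psi with
  | Beta =>
    (\int[@lebesgue_measure R]_(m1 in setT)
     \int[@lebesgue_measure R]_(m2 in setT)
     \int[@lebesgue_measure R]_(t in `]0%R, +oo[)
     \int[@lebesgue_measure R]_(e in `]0%R, +oo[)
       (posterior_density prior x (Param m1 m2 v t e))%:E)%E
  | Theta =>
    (\int[@lebesgue_measure R]_(m1 in setT)
     \int[@lebesgue_measure R]_(m2 in setT)
     \int[@lebesgue_measure R]_(b in setT)
     \int[@lebesgue_measure R]_(e in `]0%R, +oo[)
       (posterior_density prior x (Param m1 m2 b v e))%:E)%E
  | Eta =>
    (\int[@lebesgue_measure R]_(m1 in setT)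
     \int[@lebesgue_measure R]_(m2 in setT)
     \int[@lebesgue_measure R]_(b in setT)
     \int[@lebesgue_measure R]_(t in `]0%R, +oo[)
       (posterior_density prior x (Param m1 m2 b t v))%:E)%E
  end.

Definition posterior_prob (R : realType) (psi : interest)
    (prior : param R -> R) (n : nat) (x : 'I_n -> R * R) (A : set R) : \bar R :=
  (\int[@lebesgue_measure R]_(v in A `&` interest_range psi)
     marginal_density psi prior x v)%E.

Definition hpd_set (R : realType) (psi : interest) (prior : param R -> R)
    (n : nat) (x : 'I_n -> R * R) (k : R) : set R :=
  [set v | interest_range psi v /\
           (k%:E <= marginal_density psi prior x v)%E].

(* [k] is a function of the data, constrained only at samples for which the
   posterior can be normalized. *)
Definition hpd_cutoff (R : realType) (psi : interest) (prior : param R -> R)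
    (alpha : R) (k : forall n : nat, ('I_n -> R * R) -> R) : Prop :=
  forall (n : nat) (x : 'I_n -> R * R), (3 <= n)%N ->
    proper_posterior prior x ->
    posterior_prob psi prior x (hpd_set psi prior x (k n x)) = (1 - alpha)%:E.

(* The samples form a triangular array: for each [n], an i.i.d. sample of size
   [n] on some probability space.  The initial segments of a single infinite
   i.i.d. sequence are the special case of constant [T] and [P].  The cutoff is
   required to be a random variable, so that its coverage event is measurable. *)
Definition hpd_matching (R : realType) (prior : param R -> R)
    (psi : interest) : Prop :=
  forall (alpha : R) (k : forall n : nat, ('I_n -> R * R) -> R),
    0 < alpha < 1 ->
    hpd_cutoff psi prior alpha k ->
  forall w : param R, valid_param w ->
  forall (d : nat -> measure_display) (T : forall n, measurableType (d n))
    (P : forall n, probability (T n) R)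
    (X : forall n, 'I_n -> T n -> R * R),
    (forall n, iid_density (P n) (X n) (bvn_density w)) ->
    (forall n, measurable_fun setT (fun s : T n => k n (fun i => X n i s))) ->
  (fun n : nat =>
     fine (P n [set s | hpd_set psi prior (fun i => X n i s)
                          (k n (fun i => X n i s)) (interest_val psi w)])
     - (1 - alpha) : R^o)
  =o_\oo (fun n : nat => n%:R^-1 : R^o).

(* Main.v *)
Require Import Defs.
From HB Require Import structures.
From mathcomp Require Import all_boot all_order all_algebra.
From mathcomp Require Import all_classical all_reals all_analysis.
From mathcomp Require Import measurable_realfun ring.
Set Implicit Arguments.
Unset Strict Implicit.
Unset Printing Implicit Defensive.
Import Order.TTheory GRing.Theory Num.Theory.
Import numFieldTopology.Exports numFieldNormedType.Exports.
Local Open Scope classical_set_scope.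
Local Open Scope ring_scope.

(**
The coverage probability is exactly 1 - alpha for every n >= 3.  Writing
a^2 = theta / eta and d^2 = theta * eta, the parameter is the affine map
g : (z1, z2) |-> (mu1 + a z1, mu2 + beta a z1 + d z2) that carries a standard
normal pair to one observation, and the prior 1 / (theta eta) is right Haar
measure on the group of these maps.  If (u, s, r) denotes the estimate of
(beta, theta, eta) read off the sums of squares of the sample, the pivots
(beta - u) / r, theta / s and eta / r are invariant under the group, so each
marginal posterior density is a fixed density g_n moved by a location-scale
change.  The sampling law of the pivot is obtained without any distribution
theory: for a fixed nonnegative weight W on samples, integrate W times the
indicator of {pivot in A} against likelihood * prior, over samples and
parameters.  Substituting x = g z and using Haar invariance gives a constant
times P (pivot in A); integrating over the parameter first gives a constant
times the integral of g_n over A.  As both constants do not depend on A, the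
pivot has density g_n, also under sampling.  The HPD set is a superlevel set of
g_n in the pivot, of probability 1 - alpha under g_n.
*)

(** The weight W is there because the prior has infinite mass: without it the double integral over
    samples and parameters is infinite and the two evaluations say nothing. W is the indicator that
    the group element read off the sample lies in a bounded box, and the group elements moving a
    given nondegenerate sample into that box have finite positive Haar measure. The space of samples
    comes with no reference measure, only with P and its product rule on rectangles. Lebesgue
    measure on samples is therefore replaced by P divided by the likelihood at the true parameter,
    and the substitution x = g z is made one observation at a time, after replacing that observation
    by an independent copy. The second obstacle is the cutoff, a measurable function of the whole
    sample. In the pivot it becomes a level of g_n that varies with the sample, and as several
    levels may have the same probability, alpha alone does not fix it. All levels of probability 1 -
    alpha have to be compared at once. All integrands are nonnegative and extended-valued, so
    Tonelli covers every exchange, including those made before any finiteness is known. *)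

Section measurable_extra.
Context d (T : measurableType d) (R : realType).
Implicit Types f : T -> R.

Lemma measurable_fun_inv f :
  measurable_fun setT f -> measurable_fun setT (fun x => (f x)^-1).
Proof.
move=> mf.
(* The square makes the base of the real power nonnegative, so that this power is an inverse; the
   factor [f x] restores the sign and gives the conventional value 0 at the zeros of [f]. *)
have -> : (fun x => (f x)^-1) = (fun x => f x * ((f x ^+ 2) `^ (-1))).
  apply/funext => x; rewrite powR_inv1 ?sqr_ge0//.
  have [->|f0] := eqVneq (f x) 0; first by rewrite invr0 mul0r.
  by field.
apply: measurable_funM => //.
exact: (measurableT_comp (measurable_powR _) (measurable_funX _ mf)).
Qed.

Lemma measurable_fun_sqrt f :
  measurable_fun setT f -> measurable_fun setT (fun x => Num.sqrt (f x)).
Proof.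
move=> mf; apply: (measurableT_comp _ mf).
by apply: continuous_measurable_fun => x; exact: sqrt_continuous.
Qed.

Lemma measurable_fun_expR f :
  measurable_fun setT f -> measurable_fun setT (fun x => expR (f x)).
Proof. by move=> mf; exact: (measurableT_comp (@measurable_expR R) mf). Qed.

Lemma measurable_fun_indic f (A : set R) : measurable A ->
  measurable_fun setT f -> measurable_fun setT (fun x => \1_A (f x) : R).
Proof. by move=> mA mf; apply: (measurableT_comp _ mf); exact: measurable_indic. Qed.

End measurable_extra.

Section image_measure.
Context d1 d2 (T1 : measurableType d1) (T2 : measurableType d2) (R : realType).
Variables (m : {measure set T1 -> \bar R}) (f : T1 -> T2).
Hypothesis mf : measurable_fun [set: T1] f.

Definition image_measure : {measure set T2 -> \bar R}.
Proof. by unshelve refine (pushforward m f : {measure set T2 -> \bar R}). Defined.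

Lemma image_measureE A : image_measure A = m (f @^-1` A).
Proof. by []. Qed.

Lemma integral_image_measure (h : T2 -> \bar R) : measurable_fun setT h ->
  (forall x, 0 <= h x)%E ->
  (\int[image_measure]_y h y = \int[m]_x h (f x))%E.
Proof. by move=> mh h0; rewrite ge0_integral_pushforward. Qed.

End image_measure.

Section integral_extra.
Local Open Scope ereal_scope.
Context d1 d2 (T1 : measurableType d1) (T2 : measurableType d2) (R : realType).
Variables (m1 : {sigma_finite_measure set T1 -> \bar R})
  (m2 : {sigma_finite_measure set T2 -> \bar R}).

Lemma measurable_fun_integral (f : T1 -> T2 -> \bar R) :
  measurable_fun setT (fun p : T1 * T2 => f p.1 p.2) ->
  (forall x y, 0 <= f x y) ->
  measurable_fun setT (fun x => \int[m2]_y f x y).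
Proof.
move=> mf f0.
exact: (@measurable_fun_fubini_tonelli_F _ _ _ _ _ m2 (fun p => f p.1 p.2)).
Qed.

Lemma integral_swap (f : T1 -> T2 -> \bar R) :
  measurable_fun setT (fun p : T1 * T2 => f p.1 p.2) ->
  (forall x y, 0 <= f x y) ->
  \int[m1]_x \int[m2]_y f x y = \int[m2]_y \int[m1]_x f x y.
Proof.
by move=> mf f0; apply: (@fubini_tonelli _ _ _ _ _ m1 m2 (fun p => f p.1 p.2)).
Qed.

End integral_extra.

(** * Affine substitution on the line *)

Section affine_change.
Local Open Scope ereal_scope.
Context (R : realType).
Notation mu := (@lebesgue_measure R).

(** The image of Lebesgue measure under x -> b + a x, multiplied by a, gives every half-open
    interval its length, hence is Lebesgue measure by uniqueness. *)
Lemma integral_affine (a b : R) (f : R -> \bar R) : (0 < a)%R ->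
  measurable_fun setT f -> (forall x, 0 <= f x) ->
  \int[mu]_x f x = a%:E * \int[mu]_x f (b + a * x)%R.
Proof.
move=> a0 mf f0.
pose phi (x : measurableTypeR R) : measurableTypeR R := (b + a * x)%R.
have mphi : measurable_fun setT phi.
  apply: measurable_funD => //; apply: measurable_funM => //.
pose a' : {nonneg R} := NngNum (ltW a0).
pose nu := mscale a' (image_measure mu mphi).
have munu A : measurable A -> mu A = nu A.
  apply: (@lebesgue_measure_unique R nu) => _ [[x y] _ <-].
  have phiE : phi @^-1` `]x, y]%classic = `]((x - b) / a)%R, ((y - b) / a)%R]%classic.
    apply/seteqP; split => z /=; rewrite !in_itv/= /phi;
      by rewrite ltr_pdivrMr// ler_pdivlMr// ltrBlDl lerBrDl (mulrC z).
  transitivity (a%:E * mu (phi @^-1` `]x, y]%classic)) => //.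
  rewrite phiE.
  rewrite !lebesgue_measure_itv/= !lte_fin ltr_pM2r ?invr_gt0// ltrD2r.
  by case: ifPn => _; rewrite ?mule0// -EFinB -EFinM; congr EFin; field; rewrite gt_eqF.
rewrite (eq_measure_integral nu); last by move=> A mA _; first [exact: munu|exact/esym/munu].
rewrite ge0_integral_mscale//=; congr (_ * _).
exact: integral_image_measure.
Qed.

End affine_change.

(** * Measures with a density, and random superlevel sets *)

Section density.
Local Open Scope ereal_scope.
Context d (T : measurableType d) (R : realType).
Variables (mu nu : {measure set T -> \bar R}) (p : T -> R).
Hypothesis mp : measurable_fun setT p.
Hypothesis p0 : forall x, (0 <= p x)%R.
Hypothesis nuE : forall A, measurable A -> nu A = \int[mu]_(x in A) (p x)%:E.

Import HBNNSimple.

(** On the level sets of simple functions this is [nuE]; monotone convergence along the simple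
    approximations of [h] passes it on to [h] itself. *)
Lemma integral_density (h : T -> \bar R) : measurable_fun setT h ->
  (forall x, 0 <= h x) -> \int[nu]_x h x = \int[mu]_x (h x * (p x)%:E).
Proof.
move=> mh h0; pose k := nnsfun_approx measurableT mh.
have mpE : measurable_fun setT (EFin \o p) by exact/measurable_EFinP.
have kh x : (k n x)%:E @[n --> \oo] --> h x by apply: cvg_nnsfun_approx.
have -> : \int[nu]_x h x = lim (\int[nu]_x (EFin \o k n) x @[n --> \oo]).
  rewrite -monotone_convergence//.
  - by apply: eq_integral => x _; apply/esym/cvg_lim => //; exact: kh.
  - by move=> n; exact/measurable_EFinP.
  - by move=> n x _ //=; rewrite lee_fin.
  - by move=> x _ a b ab; rewrite lee_fin; exact/lefP/nd_nnsfun_approx.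
have -> : \int[mu]_x (h x * (p x)%:E) =
    lim (\int[mu]_x ((EFin \o k n) x * (p x)%:E) @[n --> \oo]).
  rewrite -monotone_convergence//.
  - apply: eq_integral => x _; apply/esym/cvg_lim => //.
    by apply: cvgeZr => //; exact: kh.
  - by move=> n; apply: emeasurable_funM => //; exact/measurable_EFinP.
  - by move=> n x _ //=; rewrite mule_ge0 ?lee_fin.
  - by move=> x _ a b ab /=; rewrite lee_wpmul2r ?lee_fin//; exact/lefP/nd_nnsfun_approx.
congr (lim _); congr (_ @ \oo); apply/funext => n /=.
have mk r : measurable_fun setT (fun x => (r * \1_(k n @^-1` [set r]) x)%:E).
  by apply/measurable_EFinP; exact: measurable_funM.
transitivity (\int[nu]_x
   (\sum_(y \in range (k n)) (y * \1_(k n @^-1` [set y]) x)%:E)).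
  by apply: eq_integral => t tE; rewrite /= fimfunE -fsumEFin.
rewrite ge0_integral_fsum//; last by move=> m y Ey; exact: nnfun_muleindic_ge0.
transitivity (\int[mu]_x (\sum_(y \in range (k n))
    (y * \1_(k n @^-1` [set y]) x)%:E * (p x)%:E)); last first.
  apply: eq_integral => x xE.
  rewrite -ge0_mule_fsuml => [|y]; last exact: nnfun_muleindic_ge0.
  by rewrite fsumEFin // -(fimfunE _ x).
rewrite ge0_integral_fsum//; last 2 first.
  - by move=> y; exact: emeasurable_funM.
  - by move=> m y Ey; rewrite mule_ge0 ?lee_fin// -lee_fin nnfun_muleindic_ge0.
apply: eq_fsbigr => r rhn.
rewrite [LHS]integralZl_indic_nnsfun// integral_indic// setIT.
have [r0|r0] := ltP r 0%R.
  rewrite preimage_nnfun0// measure0 mule0 integral0_eq// => x _.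
  by rewrite indic0 mulr0 mul0e.
under eq_integral do rewrite EFinM -muleA.
rewrite ge0_integralZl//.
- rewrite nuE//; congr (_ * _); rewrite integral_mkcond.
  apply: eq_integral => x _; rewrite /patch indicE.
  by case: (x \in _); rewrite ?mul1e ?mul0e.
- by apply: emeasurable_funM => //; exact/measurable_EFinP.
- by move=> x _; rewrite mule_ge0 ?lee_fin.
Qed.

End density.

Section coverage.
Local Open Scope ereal_scope.
Context d (T : measurableType d) (R : realType) (P : probability T R).

Lemma measure_eq_negligible (A B : set T) : measurable A -> measurable B ->
  P.-negligible (A `\` B) -> P.-negligible (B `\` A) -> P A = P B.
Proof.
move=> mA mB /(measure_negligible (measurableD mA mB)) AB0
  /(measure_negligible (measurableD mB mA)) BA0.
by rewrite (measureDI P mA mB) (measureDI P mB mA) AB0 BA0 setIC.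
Qed.

(* The superlevel sets [V >= c] of probability [p] are nested, hence equal up
   to null sets, and countably many of them are cofinal: a random level choosing
   among them does not matter. *)
Lemma superlevel_random_cutoff (V : T -> \bar R) (kap : T -> R) (N : set T)
    (p : \bar R) :
  measurable_fun setT V -> P.-negligible N -> ~ N = setT ->
  (forall s, ~ N s -> P [set u | (kap s)%:E <= V u] = p) ->
  measurable [set s | (kap s)%:E <= V s] ->
  P [set s | (kap s)%:E <= V s] = p.
Proof.
move=> mV N0 NT kapP mE.
pose L (c : R) := [set u | c%:E <= V u].
pose C := [set c | P (L c) = p].
have mL c : measurable (L c).
  by rewrite -[L c]setTI; exact: emeasurable_fun_c_infty.
have [s0 Ns0] : exists s0, ~ N s0.
  by apply/not_existsP => h; apply: NT; apply/seteqP; split => // x _; move: (h x) => /contrapT.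
pose c0 := kap s0; have Cc0 : C c0 by exact: kapP.
have pfin : p \is a fin_num by rewrite -Cc0 fin_num_measure.
rewrite -Cc0.
have LS a b : (a <= b)%R -> L b `<=` L a.
  by move=> ab u /=; apply: le_trans; rewrite lee_fin.
have null a b : C a -> C b -> P.-negligible (L a `\` L b).
  move=> Ca Cb; have [ab|ba] := leP a b; last first.
    by rewrite (_ : _ `\` _ = set0) ?setD_eq0; [exact: negligible_set0|apply: LS; exact: ltW].
  apply/negligibleP; first exact: measurableD.
  rewrite measureD//; last by rewrite -ge0_fin_numE// fin_num_measure.
  rewrite setIidr; last exact: LS.
  by rewrite [X in X - _](Ca : P (L a) = p) [X in _ - X](Cb : P (L b) = p) subee.
(* Countable choice of good levels: one above each rational, one below each rational, and the least
   one. The default [c0] is itself good, so every chosen level lies in [C] even where the request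
   cannot be met. *)
pose up (q : rat) := xget c0 [set c | C c /\ (ratr q < c)%R].
pose lo (q : rat) := xget c0 [set c | C c /\ (c < ratr q)%R].
have Cup q : C (up q) by rewrite /up; case: xgetP => // x _ [].
have Clo q : C (lo q) by rewrite /lo; case: xgetP => // x _ [].
pose mn := xget c0 [set c | C c /\ forall c', C c' -> (c <= c')%R].
have Cmn : C mn by rewrite /mn; case: xgetP => // x _ [].
have nullrat (F : rat -> set T) :
    (forall q, P.-negligible (F q)) -> P.-negligible (\bigcup_q F q).
  move=> HF; have /countable_bijP[B /card_esym /pcard_eqP[f]] :
    countable [set: rat] by exact: countableP.
  apply: (@negligibleS _ _ _ _ (\bigcup_k (F (f k)))).
    move=> x [q _ Fq]; have [k Bk kq] : (f @` B) q by apply: surj.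
    by exists k => //; rewrite kq.
  exact: negligible_bigcup.
apply: measure_eq_negligible => //.
(* Either a good level lies below [kap s], and a rational between them yields a [lo q] still below
   [kap s]; or [kap s] is the least good level, which is then [mn]. *)
- apply: (@negligibleS _ _ _ _ (N `|` ((L mn `\` L c0) `|` \bigcup_q (L (lo q) `\` L c0)))).
    move=> s [/= ks nc0]; have [?|Ns] := pselect (N s); [by left|right].
    have Ck : C (kap s) by exact: kapP.
    have [[c' [Cc' c'k]]|h] := pselect (exists c', C c' /\ (c' < kap s)%R).
      right; have [q] := rat_in_itvoo c'k; rewrite in_itv/= => /andP[c'q qk].
      exists q => //; split => //=.
      have [? lq] : C (lo q) /\ (lo q < ratr q)%R.
        by rewrite /lo; case: xgetP => [x _ //|/(_ c')[]].
      by apply: (le_trans _ ks); rewrite lee_fin ltW// (lt_trans lq).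
    left; split => //; apply: (le_trans _ ks); rewrite lee_fin /mn.
    case: xgetP => [x _ [_]|/(_ (kap s))[]]; first exact.
    split=> // c' Cc'; rewrite leNgt; apply/negP => c'k; apply: h.
    by exists c'.
  apply: negligibleU => //; apply: negligibleU; first exact: null.
  by apply: nullrat => q; exact: null.
(* Here [V s] is strictly below [kap s], so a rational always fits in between, and [up q] exceeds
   it; no extremal level has to be added. *)
- apply: (@negligibleS _ _ _ _ (N `|` \bigcup_q (L c0 `\` L (up q)))).
    move=> s [/= c0s nk]; have [?|Ns] := pselect (N s); [by left|right].
    have Ck : C (kap s) by exact: kapP.
    move/negP : nk; rewrite -ltNge => nk.
    have Vfin : V s \is a fin_num.
      rewrite fin_numElt (lt_le_trans _ c0s) ?ltNyr//= (lt_trans nk) ?ltry//.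
    have : (fine (V s) < kap s)%R by rewrite -lte_fin fineK.
    move=> /rat_in_itvoo[q]; rewrite in_itv/= => /andP[Vq qk].
    exists q => //; split => //=; apply/negP; rewrite -ltNge.
    have [? uq] : C (up q) /\ (ratr q < up q)%R.
      by rewrite /up; case: xgetP => [x _ //|/(_ (kap s))[]].
    by rewrite -(fineK Vfin) lte_fin (lt_trans Vq).
  apply: negligibleU => //.
  by apply: nullrat => q; exact: null.
Qed.

End coverage.

(** * Iterated integrals over the parameter space *)

Section measurable_combinators.
Context d (U : measurableType d) (R : realType).

Lemma mfun_fst d1 d2 (A : measurableType d1) (B : measurableType d2)
  (f : U -> A * B) : measurable_fun setT f -> measurable_fun setT (fun u => (f u).1).
Proof. by move=> mf; apply: (measurableT_comp _ mf). Qed.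

Lemma mfun_snd d1 d2 (A : measurableType d1) (B : measurableType d2)
  (f : U -> A * B) : measurable_fun setT f -> measurable_fun setT (fun u => (f u).2).
Proof. by move=> mf; apply: (measurableT_comp _ mf). Qed.

Lemma mfun_D (f g : U -> R) : measurable_fun setT f -> measurable_fun setT g ->
  measurable_fun setT (fun u => f u + g u).
Proof. exact: measurable_funD. Qed.

Lemma mfun_N (f : U -> R) : measurable_fun setT f ->
  measurable_fun setT (fun u => - f u).
Proof. exact: measurable_funN. Qed.

Lemma mfun_M (f g : U -> R) : measurable_fun setT f -> measurable_fun setT g ->
  measurable_fun setT (fun u => f u * g u).
Proof. exact: measurable_funM. Qed.

Lemma mfun_EFin (f : U -> R) : measurable_fun setT f ->
  measurable_fun setT (fun u => (f u)%:E).
Proof. by move=> mf; exact/measurable_EFinP. Qed.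

Lemma mfun_eM (f g : U -> \bar R) : measurable_fun setT f -> measurable_fun setT g ->
  measurable_fun setT (fun u => f u * g u)%E.
Proof. exact: emeasurable_funM. Qed.

Lemma mfun_pos_if (f g : U -> R) : measurable_fun setT f -> measurable_fun setT g ->
  measurable_fun setT (fun u => if 0 < f u then g u else 0).
Proof.
move=> mf mg.
rewrite (_ : (fun _ => _) = (fun u => (\1_`]0, +oo[%classic (f u) : R) * g u)).
  by apply: mfun_M => //; exact: measurable_fun_indic.
apply/funext => u; rewrite indicE mem_setE/= in_itv/= andbT.
by case: ifPn; rewrite ?mul1r ?mul0r.
Qed.

End measurable_combinators.

Ltac mfun_step := cbv beta; lazymatch goal with
  | H : measurable_fun _ ?f |- measurable_fun _ ?f => exact: H
  | |- measurable_fun _ fst => exact: measurable_fst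
  | |- measurable_fun _ snd => exact: measurable_snd
  | |- measurable_fun _ (fun u => u) => exact: measurable_id
  | |- measurable_fun _ (fun u => fst (@?a u)) => apply: mfun_fst
  | |- measurable_fun _ (fun u => snd (@?a u)) => apply: mfun_snd
  | |- measurable_fun _ (fun u => pair (@?a u) (@?b u)) => apply: measurable_fun_pair
  | |- measurable_fun _ (fun u => EFin (@?a u)) => apply: mfun_EFin
  | |- measurable_fun _ (fun u => (@?a u + @?b u)%R) => apply: mfun_D
  | |- measurable_fun _ (fun u => (- @?a u)%R) => apply: mfun_N
  | |- measurable_fun _ (fun u => (@?a u * @?b u)%R) => apply: mfun_M
  | |- measurable_fun _ (fun u => (@?a u ^+ ?n)%R) => apply: measurable_funX
  | |- measurable_fun _ (fun u => ((@?a u)^-1)%R) => apply: measurable_fun_inv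
  | |- measurable_fun _ (fun u => expR (@?a u)) => apply: measurable_fun_expR
  | |- measurable_fun _ (fun u => Num.sqrt (@?a u)) => apply: measurable_fun_sqrt
  | H : measurable_fun _ ?f |- measurable_fun _ (fun u => ?f (@?g u)) =>
      apply: (measurableT_comp H)
  | |- measurable_fun _ _ => exact: measurable_cst
  end.
Ltac mfun := repeat mfun_step.

(* Joint measurability is phrased by composition with arbitrary measurable
   arguments, which spares all reassociations of nested pairs. *)
Definition jmeas3 (R : realType) d1 (A : measurableType d1)
    (f : A -> R -> R -> \bar R) :=
  forall d (U : measurableType d) (a : U -> A) (x1 x2 : U -> R),
  measurable_fun setT a ->
  measurable_fun setT x1 -> measurable_fun setT x2 ->
  measurable_fun setT (fun u => f (a u) (x1 u) (x2 u)).

Definition jmeas4 (R : realType) d1 (A : measurableType d1)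
    (f : A -> R -> R -> R -> \bar R) :=
  forall d (U : measurableType d) (a : U -> A) (x1 x2 x3 : U -> R),
  measurable_fun setT a ->
  measurable_fun setT x1 -> measurable_fun setT x2 -> measurable_fun setT x3 ->
  measurable_fun setT (fun u => f (a u) (x1 u) (x2 u) (x3 u)).

Definition jmeas5 (R : realType) d1 (A : measurableType d1)
    (f : A -> R -> R -> R -> R -> \bar R) :=
  forall d (U : measurableType d) (a : U -> A) (x1 x2 x3 x4 : U -> R),
  measurable_fun setT a ->
  measurable_fun setT x1 -> measurable_fun setT x2 -> measurable_fun setT x3 ->
  measurable_fun setT x4 ->
  measurable_fun setT (fun u => f (a u) (x1 u) (x2 u) (x3 u) (x4 u)).

Definition jmeas6 (R : realType) d1 (A : measurableType d1)
    (f : A -> R -> R -> R -> R -> R -> \bar R) :=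
  forall d (U : measurableType d) (a : U -> A) (x1 x2 x3 x4 x5 : U -> R),
  measurable_fun setT a ->
  measurable_fun setT x1 -> measurable_fun setT x2 -> measurable_fun setT x3 ->
  measurable_fun setT x4 -> measurable_fun setT x5 ->
  measurable_fun setT (fun u => f (a u) (x1 u) (x2 u) (x3 u) (x4 u) (x5 u)).

Section iterated.
Local Open Scope ereal_scope.
Context (R : realType).
Notation mu := (@lebesgue_measure R).

Lemma mfun_int d (U : measurableType d) (f : U -> R -> \bar R) :
  measurable_fun setT (fun p : U * R => f p.1 p.2) ->
  (forall x y, 0 <= f x y) ->
  measurable_fun setT (fun x => \int[mu]_y f x y).
Proof. exact: (@measurable_fun_integral _ _ _ _ _ mu). Qed.

Section pull.
Context d1 (A : measurableType d1) (m : {sigma_finite_measure set A -> \bar R}).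

(** Tonelli one variable at a time, each [pull] resting on the previous one. The outer space is
    arbitrary, as it serves both as the sample space and as a coordinate of the parameter. *)
Lemma pull2 (f : A -> R -> R -> \bar R) : jmeas3 f ->
  (forall a x y, 0 <= f a x y) ->
  \int[m]_a \int[mu]_x \int[mu]_y f a x y = \int[mu]_x \int[mu]_y \int[m]_a f a x y.
Proof.
move=> mf f0.
rewrite integral_swap.
- apply: eq_integral => x _; apply: integral_swap => //; apply: mf; mfun.
- by apply: mfun_int => //; apply: mf; mfun.
- by move=> *; exact: integral_ge0.
Qed.

Lemma pull3 (f : A -> R -> R -> R -> \bar R) : jmeas4 f ->
  (forall a x y z, 0 <= f a x y z) ->
  \int[m]_a \int[mu]_x \int[mu]_y \int[mu]_z f a x y z =
  \int[mu]_x \int[mu]_y \int[mu]_z \int[m]_a f a x y z.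
Proof.
move=> mf f0.
rewrite integral_swap.
- apply: eq_integral => x _; apply: pull2 => // d U a y z ma my mz; apply: mf; mfun.
- apply: mfun_int => [|*]; last exact: integral_ge0.
  by apply: mfun_int => //; apply: mf; mfun.
- by move=> *; do 2 apply: integral_ge0 => *.
Qed.

Lemma pull4 (f : A -> R -> R -> R -> R -> \bar R) : jmeas5 f ->
  (forall a x y z t, 0 <= f a x y z t) ->
  \int[m]_a \int[mu]_x \int[mu]_y \int[mu]_z \int[mu]_t f a x y z t =
  \int[mu]_x \int[mu]_y \int[mu]_z \int[mu]_t \int[m]_a f a x y z t.
Proof.
move=> mf f0.
rewrite integral_swap.
- apply: eq_integral => x _.
  apply: pull3 => // d U a y z t ma my mz mt; apply: mf; mfun.
- do 2 (apply: mfun_int => [|*]; last by do ?[apply: integral_ge0 => *]).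
  by apply: mfun_int => //; apply: mf; mfun.
- by move=> *; do 3 apply: integral_ge0 => *.
Qed.

End pull.

(** All variables run over the whole line; the positivity of theta and eta is built into the
    integrands, which vanish elsewhere. Affine substitutions then require no tracking of domains. *)
Definition int5 (f : R -> R -> R -> R -> R -> \bar R) :=
  \int[mu]_m1 \int[mu]_m2 \int[mu]_b \int[mu]_t \int[mu]_e f m1 m2 b t e.

Lemma pull5 d1 (A : measurableType d1) (m : {sigma_finite_measure set A -> \bar R})
  (f : A -> R -> R -> R -> R -> R -> \bar R) : jmeas6 f ->
  (forall a x y z t e, 0 <= f a x y z t e) ->
  \int[m]_a int5 (f a) = int5 (fun x y z t e => \int[m]_a f a x y z t e).
Proof.
move=> mf f0; rewrite /int5.
rewrite integral_swap.
- apply: eq_integral => x _.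
  apply: pull4 => // d U a y z t e ma my mz mt me; apply: mf; mfun.
- do 3 (apply: mfun_int => [|*]; last by do ?[apply: integral_ge0 => *]).
  by apply: mfun_int => //; apply: mf; mfun.
- by move=> *; do 4 apply: integral_ge0 => *.
Qed.

Definition imarg (psi : interest) (f : R -> R -> R -> R -> R -> \bar R) (v : R) :=
  match psi with
  | Beta => \int[mu]_m1 \int[mu]_m2 \int[mu]_t \int[mu]_e f m1 m2 v t e
  | Theta => \int[mu]_m1 \int[mu]_m2 \int[mu]_b \int[mu]_e f m1 m2 b v e
  | Eta => \int[mu]_m1 \int[mu]_m2 \int[mu]_b \int[mu]_t f m1 m2 b t v
  end.

Lemma imarg_ge0 psi f v : (forall x y z t e, 0 <= f x y z t e) -> 0 <= imarg psi f v.
Proof. by move=> f0; case: psi; do 4 apply: integral_ge0 => *. Qed.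

Lemma int5_ge0 f : (forall x y z t e, 0 <= f x y z t e) -> 0 <= int5 f.
Proof. by move=> f0; do 5 apply: integral_ge0 => *. Qed.

Definition jm5 (f : R -> R -> R -> R -> R -> \bar R) := jmeas5 f.

Lemma int5_imarg psi f : jm5 f -> (forall x y z t e, 0 <= f x y z t e) ->
  int5 f = \int[mu]_v imarg psi f v.
Proof.
move=> mf f0; rewrite /int5; case: psi => /=.
- apply/esym/(@pull2 _ _ mu (fun v m1 m2 => \int[mu]_t \int[mu]_e f m1 m2 v t e)).
    move=> d U v m1 m2 mv mm1 mm2.
    apply: mfun_int => [|*]; last by do ?[apply: integral_ge0 => *].
    by apply: mfun_int => //; apply: mf; mfun.
  by move=> *; do 2 apply: integral_ge0 => *.
- apply/esym/(@pull3 _ _ mu (fun v m1 m2 b => \int[mu]_e f m1 m2 b v e)).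
    move=> d U v m1 m2 b mv mm1 mm2 mb.
    by apply: mfun_int => //; apply: mf; mfun.
  by move=> *; apply: integral_ge0 => *.
- apply/esym/(@pull4 _ _ mu (fun v m1 m2 b t => f m1 m2 b t v)) => //.
  by move=> d U v m1 m2 b t mv mm1 mm2 mb mt; apply: mf; mfun.
Qed.

(** The order suited to translations in the group: the shift of each location variable depends only
    on the variables integrated outside it. *)
Lemma int5_haar_order f : jm5 f -> (forall x y z t e, 0 <= f x y z t e) ->
  int5 f = \int[mu]_t \int[mu]_e \int[mu]_b \int[mu]_m1 \int[mu]_m2 f m1 m2 b t e.
Proof.
move=> mf f0.
transitivity (\int[mu]_t imarg Theta f t); first exact: int5_imarg.
apply: eq_integral => t _; rewrite /imarg.
transitivity (\int[mu]_e \int[mu]_m1 \int[mu]_m2 \int[mu]_b f m1 m2 b t e).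
  apply/esym/(@pull3 _ _ mu (fun e m1 m2 b => f m1 m2 b t e)) => //.
  by move=> d U e m1 m2 b me mm1 mm2 mb; apply: mf; mfun.
apply: eq_integral => e _.
apply/esym/(@pull2 _ _ mu (fun b m1 m2 => f m1 m2 b t e)) => //.
by move=> d U b m1 m2 mb mm1 mm2; apply: mf; mfun.
Qed.

End iterated.

(** * Left translations of the parameter space and their Jacobians *)

Section substitution.
Local Open Scope ereal_scope.
Context (R : realType).
Notation mu := (@lebesgue_measure R).

Lemma integral4Z (k : R) (f : R -> R -> R -> R -> \bar R) : (0 <= k)%R ->
  jmeas4 (f : R -> _) -> (forall x y z t, 0 <= f x y z t) ->
  \int[mu]_x \int[mu]_y \int[mu]_z \int[mu]_t (k%:E * f x y z t) =
  k%:E * \int[mu]_x \int[mu]_y \int[mu]_z \int[mu]_t f x y z t.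
Proof.
move=> k0 mf f0.
rewrite -ge0_integralZl_EFin//; last 2 first.
- by move=> *; do 3 apply: integral_ge0 => *.
- do 2 (apply: mfun_int => [|*]; last by do ?[apply: integral_ge0 => *]).
  by apply: mfun_int => //; apply: mf; mfun.
apply: eq_integral => x _.
rewrite -ge0_integralZl_EFin//; last 2 first.
- by move=> *; do 2 apply: integral_ge0 => *.
- apply: mfun_int => [|*]; last exact: integral_ge0.
  by apply: mfun_int => //; apply: mf; mfun.
apply: eq_integral => y _.
rewrite -ge0_integralZl_EFin//; last 2 first.
- by move=> *; exact: integral_ge0.
- by apply: mfun_int => //; apply: mf; mfun.
apply: eq_integral => z _.
by rewrite -ge0_integralZl_EFin//; apply: mf; mfun.
Qed.

Lemma integral_affine_scale (a c k : R) (F G : R -> \bar R) : (0 < a)%R -> (0 <= k)%R ->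
  measurable_fun setT F -> (forall x, 0 <= F x) ->
  measurable_fun setT G -> (forall x, 0 <= G x) ->
  (forall x, F (c + a * x)%R = k%:E * G x) ->
  \int[mu]_x F x = (a * k)%:E * \int[mu]_x G x.
Proof.
move=> a0 k0 mF F0 mG G0 FG.
rewrite (integral_affine c a0 mF F0) EFinM -muleA; congr (_ * _).
by rewrite -ge0_integralZl_EFin//; apply: eq_integral => x _.
Qed.

(** The shift [c2] may depend on the first variable: the substitution is triangular, so its Jacobian
    is still the product of the scales. The nested product ending in 1 is the shape left by
    successive uses of [integral_affine_scale]. *)
Lemma integral4_affine (f : R -> R -> R -> R -> \bar R) (a1 a2 a3 a4 c1 c3 c4 : R)
    (c2 : R -> R) : jmeas4 (f : R -> _) -> (forall x y z t, 0 <= f x y z t) ->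
  (0 < a1)%R -> (0 < a2)%R -> (0 < a3)%R -> (0 < a4)%R -> measurable_fun setT c2 ->
  \int[mu]_x \int[mu]_y \int[mu]_z \int[mu]_t f x y z t =
  (a1 * (a2 * (a3 * (a4 * 1))))%:E * \int[mu]_x \int[mu]_y \int[mu]_z \int[mu]_t
    f (c1 + a1 * x)%R (c2 x + a2 * y)%R (c3 + a3 * z)%R (c4 + a4 * t)%R.
Proof.
move=> mf f0 a1_gt0 a2_gt0 a3_gt0 a4_gt0 mc2.
have k4 : (0 <= a4 * 1)%R by rewrite mulr1 ltW.
have k3 : (0 <= a3 * (a4 * 1))%R by rewrite mulr_ge0// ltW.
have k2 : (0 <= a2 * (a3 * (a4 * 1)))%R by rewrite mulr_ge0// ltW.
apply: (@integral_affine_scale _ c1) => //.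
- do 2 (apply: mfun_int => [|*]; last by do ?[apply: integral_ge0 => *]).
  by apply: mfun_int => //; apply: mf; mfun.
- by move=> x; do 3 apply: integral_ge0 => *.
- do 2 (apply: mfun_int => [|*]; last by do ?[apply: integral_ge0 => *]).
  by apply: mfun_int => //; apply: mf; mfun.
- by move=> x; do 3 apply: integral_ge0 => *.
move=> x; apply: (@integral_affine_scale _ (c2 x)) => //.
- apply: mfun_int => [|*]; last exact: integral_ge0.
  by apply: mfun_int => //; apply: mf; mfun.
- by move=> y; do 2 apply: integral_ge0 => *.
- apply: mfun_int => [|*]; last exact: integral_ge0.
  by apply: mfun_int => //; apply: mf; mfun.
- by move=> y; do 2 apply: integral_ge0 => *.
move=> y; apply: (@integral_affine_scale _ c3) => //.
- by apply: mfun_int => //; apply: mf; mfun.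
- by move=> z; apply: integral_ge0 => *.
- by apply: mfun_int => //; apply: mf; mfun.
- by move=> z; apply: integral_ge0 => *.
move=> z; apply: (@integral_affine_scale _ c4) => //.
- by apply: (mf _ R); mfun.
- by apply: mf; mfun.
by move=> t; rewrite mul1e.
Qed.

(** Composition with left translation in the group: composing the map with locations [x0], [y0],
    slope [b0] and scales [a], [d] after the one with parameters (m1, m2, b, t, e) gives these
    coordinates, as t is the product and e the quotient of the scales. The terms [0 +] keep the form
    required by the affine substitution. *)
Definition triangular (x0 y0 b0 a d : R) (f : R -> R -> R -> R -> R -> \bar R) :=
  fun m1 m2 b t e : R => f (x0 + a * m1)%R (y0 + b0 * a * m1 + d * m2)%R
    (b0 + d / a * b)%R (0 + a * d * t)%R (0 + d / a * e)%R.

(** Under left translation each of beta, theta and eta undergoes an affine map of itself alone, not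
    involving the other coordinates. [iloc] and [iscale] are the coefficients of that map. *)
Definition iloc (psi : interest) (b0 : R) : R :=
  match psi with Beta => b0 | _ => 0%R end.

Definition iscale (psi : interest) (a d : R) : R :=
  match psi with Theta => (a * d)%R | _ => (d / a)%R end.

Lemma iscale_gt0 psi (a d : R) : (0 < a)%R -> (0 < d)%R -> (0 < iscale psi a d)%R.
Proof. by move=> a0 d0; case: psi; rewrite /= ?divr_gt0 ?mulr_gt0. Qed.

Lemma measurable_imarg psi (f : R -> R -> R -> R -> R -> \bar R) : jm5 f -> (forall x y z t e, 0 <= f x y z t e) ->
  measurable_fun setT (imarg psi f).
Proof.
move=> mf f0; case: psi => /=;
by do 3 (apply: mfun_int => [|*]; last by do ?[apply: integral_ge0 => *]);
  apply: mfun_int => //; apply: mf; mfun.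
Qed.

Lemma imargZ psi (k : R) f v : (0 <= k)%R -> jm5 f ->
  (forall x y z t e, 0 <= f x y z t e) ->
  imarg psi (fun x y z t e => k%:E * f x y z t e) v = k%:E * imarg psi f v.
Proof.
move=> k0 mf f0; case: psi => /=.
- apply: (integral4Z (f := fun x y t e => f x y v t e)) => //.
  by move=> d U *; apply: mf; mfun.
- apply: (integral4Z (f := fun x y b e => f x y b v e)) => //.
  by move=> d U *; apply: mf; mfun.
- apply: (integral4Z (f := fun x y b t => f x y b t v)) => //.
  by move=> d U *; apply: mf; mfun.
Qed.

(** The five scales a, d, d / a, a d, d / a multiply to d^4; the coordinate of interest is not
    integrated, so its own scale is divided out. *)
Lemma imarg_triangular psi (x0 y0 b0 a d : R) f v : (0 < a)%R -> (0 < d)%R ->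
  jm5 f -> (forall x y z t e, 0 <= f x y z t e) ->
  imarg psi f (iloc psi b0 + iscale psi a d * v)%R =
  (d ^+ 4 / iscale psi a d)%:E * imarg psi (triangular x0 y0 b0 a d f) v.
Proof.
move=> a0 d0 mf f0.
have da0 : (0 < d / a)%R by rewrite divr_gt0.
have ad0 : (0 < a * d)%R by rewrite mulr_gt0.
have mc2 : measurable_fun setT (fun x : R => y0 + b0 * a * x)%R by mfun.
have an0 : a != 0%R by rewrite gt_eqF.
have dn0 : d != 0%R by rewrite gt_eqF.
case: psi; rewrite /imarg /iloc /iscale.
- apply: etrans.
    apply: (@integral4_affine (fun x y t e => f x y (b0 + d / a * v)%R t e)
      a d (a * d) (d / a) x0 0 0 (fun x => y0 + b0 * a * x)%R) => //.
    by move=> ? U *; apply: mf; mfun.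
  by congr (_%:E * _); field; rewrite an0 dn0.
- apply: etrans.
    apply: (@integral4_affine (fun x y b e => f x y b (0 + a * d * v)%R e)
      a d (d / a) (d / a) x0 b0 0 (fun x => y0 + b0 * a * x)%R) => //.
    by move=> ? U *; apply: mf; mfun.
  by congr (_%:E * _); field; rewrite an0 dn0.
- apply: etrans.
    apply: (@integral4_affine (fun x y b t => f x y b t (0 + d / a * v)%R)
      a d (d / a) (a * d) x0 b0 0 (fun x => y0 + b0 * a * x)%R) => //.
    by move=> ? U *; apply: mf; mfun.
  by congr (_%:E * _); field; rewrite an0 dn0.
Qed.

End substitution.

(** * Sums of squares and equivariance *)

Section statistics.
Context (R : realType) (n : nat).
Implicit Types x z : 'I_n -> R * R.

Definition mean1 x : R := (\sum_i (x i).1) / n%:R.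
Definition mean2 x : R := (\sum_i (x i).2) / n%:R.
Definition ss11 x : R := \sum_i ((x i).1 - mean1 x) ^+ 2.
Definition ss12 x : R := \sum_i ((x i).1 - mean1 x) * ((x i).2 - mean2 x).
Definition ss22 x : R := \sum_i ((x i).2 - mean2 x) ^+ 2.
Definition slope x : R := ss12 x / ss11 x.
Definition resid x : R := ss22 x - ss12 x ^+ 2 / ss11 x.
(** No division by the sample size: only equivariance matters, and with this choice the sums of
    squares become 1 in the normalized kernel [kern]. *)
Definition sc1 x : R := Num.sqrt (ss11 x).
Definition sc2 x : R := Num.sqrt (resid x).
Definition nondeg x := 0 < ss11 x /\ 0 < resid x.

Lemma ss11_ge0 x : 0 <= ss11 x.
Proof. by apply: sumr_ge0 => i _; exact: sqr_ge0. Qed.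

Hypothesis n_gt0 : (0 < n)%N.
Let nR0 : n%:R != 0 :> R. Proof. by rewrite pnatr_eq0 -lt0n. Qed.

Lemma sum_dev1 x : \sum_i ((x i).1 - mean1 x) = 0.
Proof.
rewrite sumrB sumr_const card_ord /mean1 -(mulr_natr (_ / _)) divfK ?subrr//.
Qed.

Lemma sum_dev2 x : \sum_i ((x i).2 - mean2 x) = 0.
Proof.
rewrite sumrB sumr_const card_ord /mean2 -(mulr_natr (_ / _)) divfK ?subrr//.
Qed.

Lemma sum_sqr1 x m1 : \sum_i ((x i).1 - m1) ^+ 2 = ss11 x + n%:R * (mean1 x - m1) ^+ 2.
Proof.
transitivity (\sum_i (((x i).1 - mean1 x) ^+ 2
  + (2 * (mean1 x - m1) * ((x i).1 - mean1 x) + (mean1 x - m1) ^+ 2))).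
  by apply: eq_bigr => i _; ring.
by rewrite !big_split/= -mulr_sumr sum_dev1 mulr0 add0r sumr_const card_ord mulr_natl.
Qed.

(** Deviations from the mean sum to zero, which kills the cross terms with the constant [K], the
    residual at the mean point; completing the square in [b] separates the slope. *)
Lemma sum_sqr_resid x m1 m2 b : 0 < ss11 x ->
  \sum_i ((x i).2 - m2 - b * ((x i).1 - m1)) ^+ 2 =
  resid x + ss11 x * (b - slope x) ^+ 2
  + n%:R * (mean2 x - m2 - b * (mean1 x - m1)) ^+ 2.
Proof.
move=> s0; pose K := mean2 x - m2 - b * (mean1 x - m1).
transitivity (\sum_i (((x i).2 - mean2 x) ^+ 2
  + (- (2 * b) * (((x i).1 - mean1 x) * ((x i).2 - mean2 x))
  + (b ^+ 2 * ((x i).1 - mean1 x) ^+ 2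
  + (2 * K * ((x i).2 - mean2 x) + (- (2 * b * K) * ((x i).1 - mean1 x) + K ^+ 2)))))).
  by apply: eq_bigr => i _; rewrite /K; ring.
rewrite !big_split/= -!mulr_sumr sum_dev1 sum_dev2 !mulr0 !add0r sumr_const card_ord.
rewrite -[_ *+ n]mulr_natl -/(ss22 x) -/(ss12 x) -/(ss11 x) -/K /resid /slope.
by field; rewrite gt_eqF.
Qed.

Lemma resid_sum x : 0 < ss11 x ->
  resid x = \sum_i ((x i).2 - mean2 x - slope x * ((x i).1 - mean1 x)) ^+ 2.
Proof.
by move=> s0; rewrite sum_sqr_resid// !subrr mulr0 subr0 expr0n/= !mulr0 !addr0.
Qed.

(** Sufficiency: the data enter only through the two means, the slope and the two sums of squares,
    that is, through the group element attached to the sample. *)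
Lemma likelihood_stat x m1 m2 b t e : 0 < ss11 x ->
  likelihood x (Param m1 m2 b t e) = ((2 * pi * t)^-1) ^+ n *
  expR (- 2^-1 * ((resid x + ss11 x * (b - slope x) ^+ 2
      + n%:R * (mean2 x - m2 - b * (mean1 x - m1)) ^+ 2) / (t * e)
    + e * (ss11 x + n%:R * (mean1 x - m1) ^+ 2) / t)).
Proof.
move=> s0; rewrite -sum_sqr_resid// -sum_sqr1 /likelihood /bvn_density/=.
rewrite big_split/= prodr_const card_ord; congr (_ * _).
rewrite -expR_sum; congr expR; rewrite -mulr_sumr big_split/=.
by rewrite mulr_suml mulr_sumr mulr_suml.
Qed.

Section equivariance.
Variables (m1 m2 b a d : R) (z x : 'I_n -> R * R).
Hypothesis a0 : 0 < a.
Hypothesis d0 : 0 < d.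
Hypothesis xE : forall i,
  x i = (m1 + a * (z i).1, m2 + b * a * (z i).1 + d * (z i).2).

Lemma mean1_affine : mean1 x = m1 + a * mean1 z.
Proof.
rewrite /mean1; under eq_bigr do rewrite xE/=.
by rewrite big_split/= -mulr_sumr sumr_const card_ord -mulr_natr; field.
Qed.

Lemma mean2_affine : mean2 x = m2 + b * a * mean1 z + d * mean2 z.
Proof.
rewrite /mean2 /mean1; under eq_bigr do rewrite xE/=.
by rewrite !big_split/= -!mulr_sumr sumr_const card_ord -mulr_natr; field.
Qed.

Lemma ss11_affine : ss11 x = a ^+ 2 * ss11 z.
Proof.
rewrite /ss11 mean1_affine mulr_sumr; apply: eq_bigr => i _.
by rewrite xE/=; ring.
Qed.

Lemma ss12_affine : ss12 x = a ^+ 2 * b * ss11 z + a * d * ss12 z.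
Proof.
rewrite /ss12 /ss11 mean1_affine mean2_affine !mulr_sumr -big_split/=.
by apply: eq_bigr => i _; rewrite xE/=; ring.
Qed.

Lemma ss22_affine :
  ss22 x = (b * a) ^+ 2 * ss11 z + 2 * b * a * d * ss12 z + d ^+ 2 * ss22 z.
Proof.
rewrite /ss22 /ss12 /ss11 mean2_affine !mulr_sumr -!big_split/=.
by apply: eq_bigr => i _; rewrite xE/=; ring.
Qed.

Let an0 : a != 0. Proof. by rewrite gt_eqF. Qed.
Let dn0 : d != 0. Proof. by rewrite gt_eqF. Qed.

Lemma resid_affine : ss11 z != 0 -> resid x = d ^+ 2 * resid z.
Proof.
by move=> s0; rewrite /resid ss11_affine ss12_affine ss22_affine; field; rewrite an0 s0.
Qed.

Lemma nondeg_affine : nondeg x <-> nondeg z.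
Proof.
rewrite /nondeg ss11_affine pmulr_rgt0 ?exprn_gt0//.
split=> -[s0]; rewrite (resid_affine (lt0r_neq0 s0)) pmulr_rgt0 ?exprn_gt0//.
Qed.

Lemma slope_affine : ss11 z != 0 -> slope x = b + d / a * slope z.
Proof.
by move=> s0; rewrite /slope ss11_affine ss12_affine; field; rewrite an0 s0.
Qed.

Lemma sc1_affine : sc1 x = a * sc1 z.
Proof. by rewrite /sc1 ss11_affine sqrtrM ?sqr_ge0// sqrtr_sqr gtr0_norm. Qed.

Lemma sc2_affine : ss11 z != 0 -> sc2 x = d * sc2 z.
Proof.
by move=> s0; rewrite /sc2 resid_affine// sqrtrM ?sqr_ge0// sqrtr_sqr gtr0_norm.
Qed.

Definition pivot (psi : interest) (v : R) (y : 'I_n -> R * R) : R :=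
  (v - iloc psi (slope y)) / iscale psi (sc1 y) (sc2 y).

(** [Param 0 0 0 1 1] is the identity of the group. The scales and the slope picked up by the
    statistics are exactly those carried by the parameter, and they cancel. *)
Lemma pivot_affine psi : nondeg z ->
  pivot psi (interest_val psi (Param m1 m2 b (a * d) (d / a))) x =
  pivot psi (interest_val psi (Param 0 0 0 1 1)) z.
Proof.
move=> [z0 z1].
have s1 : sc1 z != 0 by rewrite gt_eqF// sqrtr_gt0.
have s2 : sc2 z != 0 by rewrite gt_eqF// sqrtr_gt0.
have s0 := lt0r_neq0 z0.
rewrite /pivot; case: psi; rewrite /= sc1_affine sc2_affine// ?slope_affine//;
by field; rewrite ?s1 ?s2 ?an0 ?dn0.
Qed.

End equivariance.

Variable c : R.

Definition post x m1 m2 b t e : \bar R :=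
  (if 0 < t then if 0 < e then
     likelihood x (Param m1 m2 b t e) * (c * (t * e)^-1) else 0 else 0)%:E.

(** The unnormalized posterior for a sample whose group element is the identity (means and slope 0,
    sums of squares 1), without the constants [c] and (2 pi)^-n. *)
Definition kern (m1 m2 b t e : R) : \bar R :=
  (if 0 < t then if 0 < e then
    (t^-1) ^+ n * (t * e)^-1 * expR (- 2^-1 *
      ((1 + b ^+ 2 + n%:R * (m2 - b * m1) ^+ 2) / (t * e)
       + e * (1 + n%:R * m1 ^+ 2) / t)) else 0 else 0)%:E.

(** The last factor comes from the prior: left translation multiplies theta * eta by the square of
    [sc2]. The Jacobian is not included here. *)
Definition kconst x : R :=
  c * ((2 * pi * (sc1 x * sc2 x))^-1) ^+ n * (sc2 x ^+ 2)^-1.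

(** Translating by the group element of the sample itself normalizes all five statistics; the data
    survive only in a factor free of the parameter. *)
Lemma post_triangular x m1 m2 b t e : nondeg x ->
  triangular (mean1 x) (mean2 x) (slope x) (sc1 x) (sc2 x) (post x) m1 m2 b t e =
  ((kconst x)%:E * kern m1 m2 b t e)%E.
Proof.
move=> [x0 x1]; have a0 : 0 < sc1 x by rewrite sqrtr_gt0.
have d0 : 0 < sc2 x by rewrite sqrtr_gt0.
have [an0 dn0] := (lt0r_neq0 a0, lt0r_neq0 d0).
rewrite /triangular /post /kern !add0r -EFinM; congr EFin.
rewrite (pmulr_rgt0 t (mulr_gt0 a0 d0)) (pmulr_rgt0 e (divr_gt0 d0 a0)).
have [t0|] := ltP 0 t; last by rewrite mulr0.
have [e0|] := ltP 0 e; last by rewrite mulr0.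
have [tn0 en0] := (lt0r_neq0 t0, lt0r_neq0 e0).
have pn0 : (pi : R) != 0 by rewrite gt_eqF// pi_gt0.
rewrite likelihood_stat// /kconst.
set E1 := expR _; set E2 := expR _.
have -> : E1 = E2.
  rewrite /E1 /E2; congr expR; congr (_ * _).
  have -> : ss11 x = sc1 x ^+ 2 by rewrite sqr_sqrtr// ltW.
  have -> : resid x = sc2 x ^+ 2 by rewrite sqr_sqrtr// ltW.
  by field; rewrite an0 dn0 tn0 en0.
rewrite -!exprVn.
have -> : (2 * pi * (sc1 x * sc2 x * t))^-1 ^+ n =
   (2 * pi * (sc1 x * sc2 x))^-1 ^+ n * t^-1 ^+ n.
  by rewrite -exprMn -invfM mulrA.
by field; rewrite an0 dn0 tn0 en0.
Qed.

End statistics.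

(** * Changes of variables for an i.i.d. sample *)

Section samples.
Context (R : realType) (n : nat).
Local Notation sample := ('I_n -> R * R).

(** Measurability is read on tuples, which carry the product sigma-algebra, whereas the statistics
    are written for functions on ['I_n]. *)
Definition smeas (F : sample -> \bar R) :=
  measurable_fun setT (fun t : n.-tuple (R * R)%type => F (tnth t)).

Lemma smeas_comp (F : sample -> \bar R) d (U : measurableType d) (x : U -> sample) :
  smeas F -> (forall i, measurable_fun setT (fun u => x u i)) ->
  measurable_fun setT (fun u => F (x u)).
Proof.
move=> mF mx.
pose xt u : n.-tuple (R * R)%type := [tuple x u i | i < n].
have mxt : measurable_fun setT xt.
  apply/measurable_fun_tnthP => i.
  rewrite (_ : _ \o _ = fun u => x u i)//.
  by apply/funext => u /=; rewrite tnth_mktuple.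
rewrite (_ : (fun u => F (x u)) = (fun t : n.-tuple (R * R)%type => F (tnth t)) \o xt).
  exact: (measurableT_comp mF mxt).
apply/funext => u /=; congr F; apply/funext => i; by rewrite tnth_mktuple.
Qed.

Definition upd (i : 'I_n) (z : R * R) (x : sample) : sample :=
  fun j => if j == i then z else x j.

(** Rectangles are stable under intersection, unlike cylinders over one coordinate, so that two laws
    agreeing on them agree. *)
Lemma tuple_measurable_rect :
  @measurable _ (n.-tuple (R * R)%type) =
  <<s [set C : set (n.-tuple (R * R)%type) | exists2 B : 'I_n -> set (R * R),
        (forall i, measurable (B i)) & C = [set t | forall i, B i (tnth t i)]] >>.
Proof.
apply/seteqP; split.
- apply: smallest_sub; first exact: smallest_sigma_algebra.
  move=> C; rewrite -bigcup_seq/= => -[i _ [B mB <-]].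
  apply: sub_sigma_algebra.
  exists (fun j => if j == i then B else setT).
    by move=> j; case: ifP.
  rewrite setTI; apply/seteqP; split => t /=.
    by move=> tB j; case: eqP => // ->.
  by move=> /(_ i); rewrite eqxx.
- apply: smallest_sub; first exact: sigma_algebra_measurable.
  move=> _ [B mB ->].
  have -> : [set t : n.-tuple (R * R)%type | forall i, B i (tnth t i)] =
      \bigcap_(i in [set: 'I_n]) ((fun t : n.-tuple (R * R)%type => tnth t i) @^-1` B i).
    by apply/seteqP; split => t /= H i; [move=> _; exact: H|exact: (H i I)].
  apply: fin_bigcap_measurable => // i _.
  by rewrite -[_ @^-1` _]setTI; exact: (@measurable_tnth _ _ n i).
Qed.

End samples.

(** * Resampling and transforming one observation at a time *)

Section iid.
Local Open Scope ereal_scope.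
Context (R : realType) (n : nat) d (T : measurableType d) (P : probability T R).
Variables (X : 'I_n -> T -> R * R) (f : R * R -> R).
Hypothesis mf : measurable_fun setT f.
Hypothesis f0 : forall z, (0 <= f z)%R.
Hypothesis iidX : iid_density P X f.

Let mX i : measurable_fun setT (X i). Proof. by case: iidX. Qed.

Lemma integral_coordinate i (h : R * R -> \bar R) : measurable_fun setT h ->
  (forall z, 0 <= h z) ->
  \int[P]_s h (X i s) =
  \int[(@lebesgue_measure R \x @lebesgue_measure R)]_z (h z * (f z)%:E).
Proof.
move=> mh h0.
(* the Borel sets on [R] and on [measurableTypeR R] coincide, but their displays differ *)
have mX' : @measurable_fun _ _ T (measurableTypeR R * measurableTypeR R)%type setT (X i).
  exact: mX.
transitivity (\int[image_measure P mX']_z h z).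
  by rewrite integral_image_measure.
apply: (@integral_density _ (measurableTypeR R * measurableTypeR R)%type R
  (@lebesgue_measure R \x @lebesgue_measure R) (image_measure P mX') f mf f0 _ h mh h0) => A mA.
by case: iidX => _ /(_ i A mA) <- _.
Qed.

Let Xs s : 'I_n -> R * R := fun i => X i s.
Let Xt s : n.-tuple (R * R)%type := [tuple X i s | i < n].
Let mXt : measurable_fun setT Xt.
Proof.
apply/measurable_fun_tnthP => i.
by rewrite (_ : _ \o _ = X i)//; apply/funext => u /=; rewrite tnth_mktuple.
Qed.

Lemma tnth_Xt s : tnth (Xt s) = Xs s.
Proof. by apply/funext => i; rewrite tnth_mktuple. Qed.

Variable i : 'I_n.

Let Yt (p : T * T) : n.-tuple (R * R)%type :=
  [tuple upd i (X i p.2) (Xs p.1) j | j < n].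
Let mYt : measurable_fun setT Yt.
Proof.
apply/measurable_fun_tnthP => j.
rewrite (_ : _ \o _ = fun p => if j == i then X i p.2 else X j p.1); last first.
  by apply/funext => u /=; rewrite tnth_mktuple.
by case: (j == i); [apply: (measurableT_comp (mX i))|apply: (measurableT_comp (mX j))].
Qed.

(** Independence makes the law insensitive to replacing one observation by its counterpart from a
    second, independent run. A single coordinate can then be integrated alone with the rest of the
    sample frozen. *)
Lemma law_resample (C : set (n.-tuple (R * R)%type)) : measurable C ->
  image_measure P mXt C = image_measure (P \x P) mYt C.
Proof.
apply: (measure_unique _ (fun=> setT) (@tuple_measurable_rect R n)) => //.
- move=> _ _ [B mB ->] [D mD ->]; exists (fun j => B j `&` D j).
    by move=> j; exact: measurableI.
  apply/seteqP; split => t /=; first by move=> [H1 H2] j; split; [exact: H1|exact: H2].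
  by move=> H; split => j; case: (H j).
- move=> k; exists (fun=> setT) => //.
  by apply/seteqP; split.
- by rewrite bigcup_const.
- move=> _ [B mB ->].
  have [_ _ prodP] := iidX.
  transitivity (P (\bigcap_(j in [set: 'I_n]) (X j @^-1` B j))).
    congr (P _); apply/seteqP; split => s /=.
      by move=> H j _ /=; have := H j; rewrite tnth_mktuple.
    by move=> H j; rewrite tnth_mktuple; exact: H.
  rewrite prodP//.
  (* The constraint on coordinate [i] is lifted from the first run, since it now falls on the
     second. *)
  pose B' j := if j == i then setT else B j.
  have mB' j : measurable (B' j) by rewrite /B'; case: ifP.
  have mcap : measurable (\bigcap_(j in [set: 'I_n]) (X j @^-1` B' j)).
    apply: fin_bigcap_measurable => // j _.
    by rewrite -[_ @^-1` _]setTI; exact: mX.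
  transitivity ((P \x P) ((\bigcap_(j in [set: 'I_n]) (X j @^-1` B' j)) `*` (X i @^-1` B i))).
    rewrite product_measure1E//; last by rewrite -[_ @^-1` _]setTI; exact: mX.
    rewrite [X in _ = X * _](prodP B' mB') (bigD1 i)//= [in RHS](bigD1 i)//= /B' eqxx preimage_setT.
    rewrite probability_setT mul1e muleC; congr (_ * _).
    by apply: eq_bigr => j /negPf ->.
  congr ((P \x P) _); apply/seteqP; split => -[s s'] /=.
    move=> [H1 H2] j; rewrite tnth_mktuple /upd; case: eqP => [->//|/eqP ji].
    by have := H1 j I; rewrite /= /B' (negPf ji).
  move=> H; split; last by have := H i; rewrite tnth_mktuple /upd eqxx.
  move=> j _ /=; rewrite /B'; case: eqP => // /eqP ji.
  by have := H j; rewrite tnth_mktuple /upd (negPf ji).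
- move=> k; rewrite (le_lt_trans _ (ltry 1))//.
  by rewrite (@probability_le1 _ _ _ P)// -[X in measurable X]setTI; exact: mXt.
Qed.

Lemma integral_resample (F : ('I_n -> R * R) -> \bar R) : smeas F ->
  (forall x, 0 <= F x) ->
  \int[P]_s F (fun j => X j s) =
  \int[P]_s \int[P]_s' F (upd i (X i s') (fun j => X j s)).
Proof.
move=> mF F0.
transitivity (\int[image_measure P mXt]_t F (tnth t)).
  by rewrite integral_image_measure//; apply: eq_integral => s _; rewrite tnth_Xt.
rewrite (eq_measure_integral (image_measure (P \x P) mYt)); last first.
  by move=> A mA _; exact: law_resample.
rewrite integral_image_measure//.
pose H p := F (tnth (Yt p)).
have mH : measurable_fun setT H by exact: (measurableT_comp mF mYt).
apply: etrans; first by apply: (@fubini_tonelli1 _ _ T T R P P H mH) => p; exact: F0.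
rewrite /fubini_F /H.
apply: eq_integral => s _; apply: eq_integral => s' _ /=; congr F.
by apply/funext => j; rewrite tnth_mktuple.
Qed.

End iid.

Section tilting.
Local Open Scope ereal_scope.
Context (R : realType) (n : nat) d (T : measurableType d) (P : probability T R).
Variables (X : 'I_n -> T -> R * R) (f : R * R -> R).
Hypothesis mf : measurable_fun setT f.
Hypothesis f0 : forall z, (0 <= f z)%R.
Hypothesis iidX : iid_density P X f.
Variables (phi : R * R -> R * R) (l : R * R -> R).
Hypothesis mphi : measurable_fun setT phi.
Hypothesis ml : measurable_fun setT l.
Hypothesis l0 : forall z, (0 <= l z)%R.
Hypothesis tilt : forall i (h : R * R -> \bar R), measurable_fun setT h ->
  (forall z, 0 <= h z) ->
  \int[P]_s (h (X i s) * (l (X i s))%:E) = \int[P]_s h (phi (X i s)).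

Let mX i : measurable_fun setT (X i). Proof. by case: iidX. Qed.

(** Both sides are resampled at coordinate [i]; with the other coordinates frozen, the identity is
    the one-observation hypothesis [tilt]. *)
Lemma integral_tilt1 i (F : ('I_n -> R * R) -> \bar R) : smeas F ->
  (forall x, 0 <= F x) ->
  \int[P]_s (F (fun j => X j s) * (l (X i s))%:E) =
  \int[P]_s F (upd i (phi (X i s)) (fun j => X j s)).
Proof.
move=> mF F0.
have mupd d' (U : measurableType d') (z : U -> R * R) (x : U -> 'I_n -> R * R) :
    measurable_fun setT z -> (forall j, measurable_fun setT (fun u => x u j)) ->
    forall j, measurable_fun setT (fun u => upd i (z u) (x u) j).
  by move=> mz mx j; rewrite /upd; case: (j == i).
have mt j : measurable_fun setT (fun t : n.-tuple (R * R)%type => tnth t j).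
  exact: measurable_tnth.
apply: etrans.
  apply: (@integral_resample _ _ _ _ P X f iidX i
    (fun x => F x * (l (x i))%:E)) => //.
    apply: mfun_eM; first exact: mF.
    by apply: mfun_EFin; apply: (measurableT_comp ml).
  by move=> x; rewrite mule_ge0 ?lee_fin.
apply: esym; apply: etrans.
  apply: (@integral_resample _ _ _ _ P X f iidX i
    (fun x => F (upd i (phi (x i)) x))) => //.
  apply: (smeas_comp mF) => j.
  apply: (mupd _ _ (fun t : n.-tuple (R * R)%type => phi (tnth t i))
    (fun t => tnth t)) => //.
  exact: (measurableT_comp mphi).
apply: eq_integral => s _; apply: esym.
have updE z : upd i (phi (upd i z (X^~ s) i)) (upd i z (X^~ s)) = upd i (phi z) (X^~ s).
  by apply/funext => j; rewrite /upd eqxx; case: (j == i).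
under [RHS]eq_integral do rewrite updE.
rewrite -(@tilt i (fun z => F (upd i z (X^~ s)))) => //.
  by apply: eq_integral => s' _; rewrite /upd eqxx.
apply: (smeas_comp mF) => j; apply: (mupd _ _ id (fun=> X^~ s)) => // k.
Qed.

Lemma integral_tilt (F : ('I_n -> R * R) -> \bar R) : smeas F ->
  (forall x, 0 <= F x) ->
  \int[P]_s (F (fun j => X j s) * (\prod_(i < n) l (X i s))%:E) =
  \int[P]_s F (fun j => phi (X j s)).
Proof.
move=> mF F0.
pose mix (k : nat) (x : 'I_n -> R * R) : 'I_n -> R * R :=
  fun j => if (j < k)%N then phi (x j) else x j.
have mt j : measurable_fun setT (fun t : n.-tuple (R * R)%type => tnth t j).
  exact: measurable_tnth.
have mmix k (G : ('I_n -> R * R) -> \bar R) : smeas G -> smeas (fun x => G (mix k x)).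
  move=> mG; apply: (smeas_comp mG) => j; rewrite /mix.
  by case: (j < k)%N => //; exact: (measurableT_comp mphi).
(* Induction on the number of coordinates already transformed. The statement ranges over all [G]
   because the inductive step absorbs the factor of the next coordinate into [G]. *)
suff H k : (k <= n)%N -> forall G : ('I_n -> R * R) -> \bar R, smeas G ->
    (forall x, 0 <= G x) ->
    \int[P]_s (G (X^~ s) * (\prod_(i < n | (i < k)%N) l (X i s))%:E) =
    \int[P]_s G (mix k (X^~ s)).
  have := H n (leqnn n) F mF F0.
  have -> : \int[P]_s F (mix n (X^~ s)) = \int[P]_s F (fun j => phi (X j s)).
    by apply: eq_integral => s _; congr F; apply/funext => j; rewrite /mix ltn_ord.
  move=> <-; apply: eq_integral => s _; congr (_ * _%:E).
  by apply: eq_bigl => i; rewrite ltn_ord.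
elim: k => [_ G mG G0|k IH kn G mG G0].
  apply: eq_integral => s _; rewrite big_pred0// mule1.
  by congr G; apply/funext => j.
pose ik := Ordinal kn.
transitivity (\int[P]_s ((G (X^~ s) * (l (X ik s))%:E)
    * (\prod_(i < n | (i < k)%N) l (X i s))%:E)).
  apply: eq_integral => s _; rewrite -muleA -EFinM; congr (_ * _%:E).
  rewrite (bigD1 ik)//=; congr (_ * _)%R; apply: eq_bigl => i.
  by rewrite ltnS -val_eqE/= ltn_neqAle andbC.
apply: etrans.
  apply: (IH (ltnW kn) (fun x => G x * (l (x ik))%:E)).
    apply: mfun_eM; first exact: mG.
    by apply: mfun_EFin; apply: (measurableT_comp ml).
  by move=> x; rewrite mule_ge0 ?lee_fin.
transitivity (\int[P]_s (G (mix k (X^~ s)) * (l (X ik s))%:E)).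
  by apply: eq_integral => s _; rewrite /mix/= ltnn.
apply: etrans.
  apply: (@integral_tilt1 ik (fun x => G (mix k x))); first exact: mmix.
  by move=> x; exact: G0.
apply: eq_integral => s _; congr G; apply/funext => j; rewrite /mix /upd ltnS.
rewrite -val_eqE/= (leq_eqVlt j k); case: (j =P k :> nat) => [jk|//].
rewrite jk ltnn /=; have -> : j = ik by exact: val_inj.
by [].
Qed.

End tilting.

(** * Affine maps of the plane and the likelihood ratio *)

Section affine_plane.
Local Open Scope ereal_scope.
Context (R : realType).
Notation mu := (@lebesgue_measure R).

Lemma integral_plane (G : R * R -> \bar R) : measurable_fun setT G ->
  (forall z, 0 <= G z) -> \int[mu \x mu]_z G z = \int[mu]_x \int[mu]_y G (x, y).
Proof.
by move=> mG G0; apply: (@fubini_tonelli1 _ _ (measurableTypeR R) (measurableTypeR R) R mu mu G mG G0).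
Qed.

Lemma integral_plane_affine (G : R * R -> \bar R) (a d c g k : R) :
  (0 < a)%R -> (0 < d)%R ->
  measurable_fun setT G -> (forall z, 0 <= G z) ->
  \int[mu \x mu]_z G z =
  (a * d)%:E * \int[mu \x mu]_z G (c + a * z.1, g + k * z.1 + d * z.2)%R.
Proof.
move=> a0 d0 mG G0.
have mG' : measurable_fun setT (fun z : R * R => G (c + a * z.1, g + k * z.1 + d * z.2)%R).
  by apply: (measurableT_comp mG); mfun.
rewrite !integral_plane//.
have mGx x : measurable_fun setT (fun y => G (x, y)).
  by apply: (measurableT_comp mG); mfun.
have mGi : measurable_fun setT (fun x => \int[mu]_y G (x, y)).
  by apply: mfun_int => //; apply: (measurableT_comp mG); mfun.
have i0 x : 0 <= \int[mu]_y G (x, y) by exact: integral_ge0.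
rewrite (integral_affine c a0 mGi i0) EFinM -muleA; congr (_ * _).
rewrite -ge0_integralZl_EFin ?ltW//; last 2 first.
- by move=> x _; exact: integral_ge0.
- by apply: mfun_int => //; apply: (measurableT_comp mG); mfun.
apply: eq_integral => x _.
by rewrite (integral_affine (g + k * x)%R d0 (mGx _))//.
Qed.

Lemma integral_eq0_point (G : R -> \bar R) (c : R) :
  (forall x, x != c -> G x = 0) -> \int[mu]_x G x = 0.
Proof.
move=> Gc; rewrite -(integral_set1 G c) [RHS]integral_mkcond.
apply: eq_integral => x _; rewrite /patch; case: ifPn => //.
by rewrite notin_setE/= => /eqP/Gc.
Qed.

End affine_plane.

Section bvn.
Context (R : realType).

Definition act (m1 m2 b a d : R) (z : R * R) : R * R :=
  (m1 + a * z.1, m2 + b * a * z.1 + d * z.2).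

Definition invact (m1 m2 b a d : R) (z : R * R) : R * R :=
  ((z.1 - m1) / a, (z.2 - m2 - b * (z.1 - m1)) / d).

Lemma invactK m1 m2 b a d z : 0 < a -> 0 < d ->
  act m1 m2 b a d (invact m1 m2 b a d z) = z.
Proof.
move=> a0 d0; rewrite /act /invact/=; case: z => z1 z2 /=.
by congr (_, _); field; rewrite ?(gt_eqF a0) ?(gt_eqF d0).
Qed.

Lemma bvn_density_act m1 m2 b a d z : 0 < a -> 0 < d ->
  bvn_density (Param m1 m2 b (a * d) (d / a)) (act m1 m2 b a d z) =
  (2 * pi * (a * d))^-1 * expR (- 2^-1 * (z.2 ^+ 2 + z.1 ^+ 2)).
Proof.
move=> a0 d0; rewrite /bvn_density /act/=; congr (_ * expR (_ * _)).
by field; rewrite (gt_eqF a0) (gt_eqF d0).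
Qed.

Lemma bvn_density_gt0 (w : param R) z : valid_param w -> 0 < bvn_density w z.
Proof. by move=> [t0 e0]; rewrite mulr_gt0 ?expR_gt0// invr_gt0 !mulr_gt0 ?pi_gt0. Qed.

Lemma mfun_bvn_density d (U : measurableType d) (m1 m2 b t e : U -> R) (z : U -> R * R) :
  measurable_fun setT m1 -> measurable_fun setT m2 -> measurable_fun setT b ->
  measurable_fun setT t -> measurable_fun setT e -> measurable_fun setT z ->
  measurable_fun setT (fun u => bvn_density (Param (m1 u) (m2 u) (b u) (t u) (e u)) (z u)).
Proof. by move=> *; rewrite /bvn_density/=; mfun. Qed.

Lemma mfun_likelihood n d (U : measurableType d) (m1 m2 b t e : U -> R)
    (x : U -> 'I_n -> R * R) :
  measurable_fun setT m1 -> measurable_fun setT m2 -> measurable_fun setT b ->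
  measurable_fun setT t -> measurable_fun setT e ->
  (forall i, measurable_fun setT (fun u => x u i)) ->
  measurable_fun setT
    (fun u => likelihood (x u) (Param (m1 u) (m2 u) (b u) (t u) (e u))).
Proof.
move=> *; rewrite /likelihood.
by apply: measurable_prod => i _; apply: mfun_bvn_density.
Qed.

End bvn.

Section change_of_measure.
Local Open Scope ereal_scope.
Context (R : realType) (n : nat) d (T : measurableType d) (P : probability T R).
Variables (X : 'I_n -> T -> R * R) (m1 m2 b a dd : R).
Hypothesis a0 : (0 < a)%R.
Hypothesis d0 : (0 < dd)%R.
Let w := Param m1 m2 b (a * dd) (dd / a).
Hypothesis iidX : iid_density P X (bvn_density w).

Variables (m1' m2' b' a' d' : R).
Hypothesis a'0 : (0 < a')%R.
Hypothesis d'0 : (0 < d')%R.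
Let w' := Param m1' m2' b' (a' * d') (d' / a').

Let valid_w : valid_param w. Proof. by split => /=; [exact: mulr_gt0|exact: divr_gt0]. Qed.
Let valid_w' : valid_param w'. Proof. by split => /=; [exact: mulr_gt0|exact: divr_gt0]. Qed.

(** The likelihood ratio reweights the law under [w] into the law under [w'], and the map sending
    each observation through its standardized value does the same pointwise. This is the
    substitution x = g z expressed with [P] alone. *)
Lemma change_of_sample (F : ('I_n -> R * R) -> \bar R) : smeas F ->
  (forall x, 0 <= F x) ->
  \int[P]_s (F (X^~ s) * (likelihood (X^~ s) w' / likelihood (X^~ s) w)%:E) =
  \int[P]_s F (fun j => act m1' m2' b' a' d' (invact m1 m2 b a dd (X j s))).
Proof.
move=> mF F0.
pose phi z := act m1' m2' b' a' d' (invact m1 m2 b a dd z).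
pose l z : R := (bvn_density w' z / bvn_density w z)%R.
have mp (v : param R) : measurable_fun setT (bvn_density v).
  case: v => *; rewrite /bvn_density/=; mfun.
have ml : measurable_fun setT l by rewrite /l; mfun; exact: mp.
have mphi : measurable_fun setT phi by rewrite /phi /act /invact/=; mfun.
have p0 v z : valid_param v -> (0 <= bvn_density v z)%R.
  by move=> vv; apply: ltW; exact: bvn_density_gt0.
have l0 z : (0 <= l z)%R by rewrite divr_ge0 ?p0.
have tilt i (h : R * R -> \bar R) : measurable_fun setT h -> (forall z, 0 <= h z) ->
    \int[P]_s (h (X i s) * (l (X i s))%:E) = \int[P]_s h (phi (X i s)).
  move=> mh h0.
  have mhl : measurable_fun setT (fun z => h z * (l z)%:E) by apply: mfun_eM => //; mfun.
  have mhphi : measurable_fun setT (fun z => h (phi z)) by apply: (measurableT_comp mh).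
  have pw0 z : (0 <= bvn_density w z)%R by exact: p0.
  have hl0 z : 0 <= h z * (l z)%:E by rewrite mule_ge0 ?lee_fin.
  rewrite (integral_coordinate (mp _) pw0 iidX i mhl hl0).
  rewrite (integral_coordinate (mp _) pw0 iidX i mhphi)//.
  transitivity (\int[(@lebesgue_measure R \x @lebesgue_measure R)]_z
      (h z * (bvn_density w' z)%:E)).
    apply: eq_integral => z _; rewrite -muleA -EFinM; congr (_ * _%:E).
    by rewrite /l divfK// gt_eqF// bvn_density_gt0.
  have mhw' : measurable_fun setT (fun z => h z * (bvn_density w' z)%:E).
    by apply: mfun_eM => //; apply: mfun_EFin.
  have hw'0 z : 0 <= h z * (bvn_density w' z)%:E by rewrite mule_ge0 ?lee_fin ?p0.
  (* Coefficients of the triangular affine map [phi]: [g] is the constant of its second coordinate,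
     [k] the coefficient of the first variable there. *)
  pose g := (m2' - b' * a' * m1 / a - d' * (m2 - b * m1) / dd)%R.
  pose k := (b' * a' / a - d' * b / dd)%R.
  have aa0 : (0 < a' / a)%R by rewrite divr_gt0.
  have dd0 : (0 < d' / dd)%R by rewrite divr_gt0.
  rewrite (integral_plane_affine (m1' - a' * m1 / a)%R g k aa0 dd0 mhw' hw'0).
  have phiE z : phi z = (m1' - a' * m1 / a + a' / a * z.1, g + k * z.1 + d' / dd * z.2)%R.
    rewrite /phi /act /invact/= /g /k; congr (_, _)%R; field;
      by rewrite ?(gt_eqF a0) ?(gt_eqF d0).
  have mm : measurable_fun setT (fun z => h (phi z) * (bvn_density w' (phi z))%:E).
    by apply: mfun_eM => //; apply: mfun_EFin; apply: (measurableT_comp (mp _)).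
  rewrite (_ : (fun z => _) = (fun z => h (phi z) * (bvn_density w' (phi z))%:E)); last first.
    by apply/funext => z; rewrite phiE.
  have c0 : (0 <= a' / a * (d' / dd))%R by rewrite mulr_ge0 ?ltW.
  rewrite -(@ge0_integralZl_EFin _ (measurableTypeR R * measurableTypeR R)%type R
    (@lebesgue_measure R \x @lebesgue_measure R) setT measurableT _ _ mm _ c0)//.
  apply: eq_integral => z _; rewrite muleCA -EFinM; congr (_ * _%:E).
  (* Both densities equal a standard normal one at the same standardized point, up to factors 1 /
     (a' d') and 1 / (a d); the Jacobian is their quotient. *)
  rewrite /phi bvn_density_act// -[in RHS](invactK m1 m2 b z a0 d0) bvn_density_act//.
  have pn0 := lt0r_neq0 (pi_gt0 R).
  move: (pi : R) pn0 => q qn0.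
  by field; rewrite qn0 (lt0r_neq0 a0) (lt0r_neq0 d0) (lt0r_neq0 a'0) (lt0r_neq0 d'0).
rewrite -(integral_tilt iidX mphi ml l0 tilt mF F0).
apply: eq_integral => s _; congr (_ * _%:E).
by rewrite /likelihood /l prodf_div.
Qed.

End change_of_measure.

(** * Almost sure nondegeneracy *)

Section measurable_statistics.
Context (R : realType) (n : nat) d (U : measurableType d).
Variable x : U -> 'I_n -> R * R.
Hypothesis mx : forall i, measurable_fun setT (fun u => x u i).

Lemma mfun_mean1 : measurable_fun setT (fun u => mean1 (x u)).
Proof.
rewrite /mean1; apply: mfun_M; last by mfun.
by apply: measurable_sum => i; apply: mfun_fst.
Qed.

Lemma mfun_mean2 : measurable_fun setT (fun u => mean2 (x u)).
Proof.
rewrite /mean2; apply: mfun_M; last by mfun.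
by apply: measurable_sum => i; apply: mfun_snd.
Qed.

Lemma mfun_ss11 : measurable_fun setT (fun u => ss11 (x u)).
Proof.
apply: measurable_sum => i; have mi := mx i; have mm := mfun_mean1; mfun.
Qed.

Lemma mfun_ss12 : measurable_fun setT (fun u => ss12 (x u)).
Proof.
apply: measurable_sum => i; have mi := mx i; have mm := mfun_mean1.
have mm2 := mfun_mean2; mfun.
Qed.

Lemma mfun_ss22 : measurable_fun setT (fun u => ss22 (x u)).
Proof.
apply: measurable_sum => i; have mi := mx i; have mm := mfun_mean2; mfun.
Qed.

Lemma mfun_slope : measurable_fun setT (fun u => slope (x u)).
Proof. have m1 := mfun_ss11; have m2 := mfun_ss12; rewrite /slope; mfun. Qed.

Lemma mfun_resid : measurable_fun setT (fun u => resid (x u)).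
Proof.
have m1 := mfun_ss11; have m2 := mfun_ss12; have m3 := mfun_ss22.
rewrite /resid; mfun.
Qed.

Lemma mfun_sc1 : measurable_fun setT (fun u => sc1 (x u)).
Proof. have m1 := mfun_ss11; rewrite /sc1; mfun. Qed.

Lemma mfun_sc2 : measurable_fun setT (fun u => sc2 (x u)).
Proof. have m1 := mfun_resid; rewrite /sc2; mfun. Qed.

Lemma mfun_pivot psi (v : U -> R) : measurable_fun setT v ->
  measurable_fun setT (fun u => pivot psi (v u) (x u)).
Proof.
move=> mv; have m1 := mfun_slope; have m2 := mfun_sc1; have m3 := mfun_sc2.
by rewrite /pivot; case: psi => /=; mfun.
Qed.

End measurable_statistics.

Section nondegenerate.
Local Open Scope ereal_scope.
Context (R : realType) (n : nat) d (T : measurableType d) (P : probability T R).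
Variables (X : 'I_n -> T -> R * R) (f : R * R -> R).
Hypothesis mf : measurable_fun setT f.
Hypothesis f0 : forall z, (0 <= f z)%R.
Hypothesis iidX : iid_density P X f.
Hypothesis n3 : (3 <= n)%N.
Notation mu := (@lebesgue_measure R).

Let mX i : measurable_fun setT (X i). Proof. by case: iidX. Qed.

Let i0 : 'I_n := Ordinal (leq_trans (isT : 0 < 3)%N n3).
Let i1 : 'I_n := Ordinal (leq_trans (isT : 1 < 3)%N n3).
Let i2 : 'I_n := Ordinal n3.

Let gap (x : 'I_n -> R * R) : R := (x i1).1 - (x i0).1.
Let det (x : 'I_n -> R * R) : R :=
  ((x i1).2 - (x i0).2) * ((x i2).1 - (x i0).1) - ((x i2).2 - (x i0).2) * gap x.

(** If [ss11] vanishes, all first coordinates agree; if [resid] vanishes, all points lie on the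
    regression line, so that the first three are collinear and [det] is 0. This is where three
    observations are required. *)
Lemma nondeg_of_generic x : gap x != 0%R -> det x != 0%R -> nondeg x.
Proof.
move=> gx dx.
have s0 : (0 < ss11 x)%R.
  rewrite lt_neqAle ss11_ge0 andbT eq_sym; apply: contra gx.
  rewrite /ss11 psumr_eq0; last by move=> i _; exact: sqr_ge0.
  move=> /allP H.
  have Hi i : (x i).1 = mean1 x.
    have := H i (mem_index_enum _); rewrite /= sqrf_eq0 subr_eq0; exact/eqP.
  by rewrite /gap !Hi subrr.
split=> //; rewrite lt_neqAle eq_sym.
have n0 : (0 < n)%N by exact: leq_trans n3.
rewrite resid_sum//; apply/andP; split; last by apply: sumr_ge0 => i _; exact: sqr_ge0.
apply: contra dx; rewrite psumr_eq0; last by move=> i _; exact: sqr_ge0.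
move=> /allP H.
have Hi i : (x i).2 = (mean2 x + slope x * ((x i).1 - mean1 x))%R.
  have := H i (mem_index_enum _); rewrite /= sqrf_eq0 subr_eq0 => /eqP <-.
  by rewrite addrC subrK.
by rewrite /det /gap !Hi; apply/eqP; ring.
Qed.

Let z0 : R -> R := \1_[set 0%R].
Let z0E (y : R) : y != 0%R -> z0 y = 0%R.
Proof. by move=> y0; rewrite /z0 indicE memNset//=; apply/eqP. Qed.
Let z0_ge0 y : (0 <= z0 y)%R. Proof. by rewrite /z0 indicE. Qed.
Let mz0 d' (U : measurableType d') (g : U -> R) :
  measurable_fun setT g -> measurable_fun setT (fun u => z0 (g u)).
Proof. by move=> mg; apply: measurable_fun_indic. Qed.

Let gap0 : P [set s | gap (X^~ s) = 0%R] = 0.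
Proof.
pose F x := (z0 (gap x))%:E.
have mt j : measurable_fun setT (fun t : n.-tuple (R * R)%type => tnth t j).
  exact: measurable_tnth.
have mF : smeas F.
  apply: mfun_EFin; apply: mz0; rewrite /gap.
  by apply: mfun_D; [|apply: mfun_N]; apply: mfun_fst.
transitivity (\int[P]_s F (X^~ s)).
  rewrite -[LHS]/(P ((fun s => gap (X^~ s)) @^-1` [set 0%R])).
  rewrite -[X in P X]setIT -integral_indic//.
  rewrite -[X in measurable X]setTI.
  have mg : measurable_fun setT (fun s => gap (X^~ s)).
    by have m0 := mX i0; have m1 := mX i1; rewrite /gap; mfun.
  exact: mg.
(* Given the other observations, [gap] vanishes only when the fresh point falls on one vertical
   line, a Lebesgue null set. *)
rewrite (integral_resample iidX i1 mF); last by move=> x; rewrite lee_fin.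
apply: integral0_eq => s _.
pose h (z : R * R) := (z0 (z.1 - (X i0 s).1))%:E.
transitivity (\int[P]_s' h (X i1 s')).
  by apply: eq_integral => s' _; rewrite /F /gap /upd eqxx.
have mh : measurable_fun setT h by apply: mfun_EFin; apply: mz0; mfun.
have h0 z : 0 <= h z by rewrite lee_fin.
rewrite (integral_coordinate mf f0 iidX i1 mh h0).
have mhf : measurable_fun setT (fun z => h z * (f z)%:E).
  by apply: mfun_eM => //; apply: mfun_EFin.
rewrite integral_plane//; last by move=> z; rewrite mule_ge0 ?lee_fin.
apply: (@integral_eq0_point _ _ (X i0 s).1) => x xX.
apply: integral0_eq => y _; rewrite /h/= z0E ?mul0e//.
by rewrite subr_eq0.
Qed.

Let det0 : P [set s | gap (X^~ s) <> 0%R /\ det (X^~ s) = 0%R] = 0.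
Proof.
pose F x := ((1 - z0 (gap x)) * z0 (det x))%:E.
have mt j : measurable_fun setT (fun t : n.-tuple (R * R)%type => tnth t j).
  exact: measurable_tnth.
have z01 y : (0 <= 1 - z0 y)%R by rewrite subr_ge0 /z0 indicE; case: (_ \in _).
have mgap d' (U : measurableType d') (x : U -> 'I_n -> R * R) :
    (forall i, measurable_fun setT (fun u => x u i)) ->
    measurable_fun setT (fun u => gap (x u)).
  by move=> mx; have m0 := mx i0; have m1 := mx i1; rewrite /gap; mfun.
have mdet d' (U : measurableType d') (x : U -> 'I_n -> R * R) :
    (forall i, measurable_fun setT (fun u => x u i)) ->
    measurable_fun setT (fun u => det (x u)).
  move=> mx; have m0 := mx i0; have m1 := mx i1; have m2 := mx i2.
  by have mg := mgap _ _ _ mx; rewrite /det; mfun.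
have mF : smeas F.
  apply: mfun_EFin; apply: mfun_M; last by apply: mz0; exact: mdet.
  by apply: mfun_D; [mfun|apply: mfun_N; apply: mz0; exact: mgap].
pose E := (fun s => gap (X^~ s)) @^-1` (~` [set 0%R]) `&`
  (fun s => det (X^~ s)) @^-1` [set 0%R].
have mE : measurable E.
  apply: measurableI; rewrite -[X in measurable X]setTI.
    by apply: (mgap _ _ (fun s => X^~ s)) => //; exact: measurableC.
  exact: (mdet _ _ (fun s => X^~ s)).
transitivity (\int[P]_s F (X^~ s)).
  rewrite -[LHS]/(P E) -[X in P X]setIT -integral_indic//.
  apply: eq_integral => s _; rewrite /F /z0 !indicE; congr (_%:E).
  have z1 (y : R) : (y \in [set 0%R]) = (y == 0%R).
    by apply/idP/eqP => [/set_mem|->]; rewrite ?inE.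
  have -> : (s \in E) = (gap (X^~ s) != 0%R) && (det (X^~ s) == 0%R).
    apply/idP/andP => [/set_mem[/= /eqP ? /eqP ?]//|[/eqP ? /eqP ?]].
    by apply/mem_set; split.
  by rewrite !z1; case: eqP => _; rewrite /= ?subr0 ?subrr ?mul1r ?mul0r.
rewrite (integral_resample iidX i2 mF); last by move=> x; rewrite lee_fin mulr_ge0.
apply: integral0_eq => s _.
pose p0 := X i0 s; pose p1 := X i1 s.
pose h (z : R * R) := ((1 - z0 (p1.1 - p0.1)) *
  z0 ((p1.2 - p0.2) * (z.1 - p0.1) - (z.2 - p0.2) * (p1.1 - p0.1)))%:E.
transitivity (\int[P]_s' h (X i2 s')).
  by apply: eq_integral => s' _.
have mh : measurable_fun setT h.
  by apply: mfun_EFin; apply: mfun_M; [mfun|apply: mz0; mfun].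
have h0 z : 0 <= h z by rewrite lee_fin mulr_ge0.
rewrite (integral_coordinate mf f0 iidX i2 mh h0).
have mhf : measurable_fun setT (fun z => h z * (f z)%:E).
  by apply: mfun_eM => //; apply: mfun_EFin.
rewrite integral_plane//; last by move=> z; apply: mule_ge0 => //; rewrite lee_fin.
apply: integral0_eq => x _.
have [g0|g0] := eqVneq (p1.1 - p0.1)%R 0%R.
  have z00 : z0 0%R = 1%R by rewrite /z0 indicE mem_set.
  by apply: integral0_eq => y _; rewrite /h/= g0 z00 subrr mul0r mul0e.
(* The only exceptional ordinate at abscissa [x] is that of the line through the first two points,
   which is not vertical as their gap is nonzero. *)
apply: (@integral_eq0_point _ _
  (p0.2 + (p1.2 - p0.2) * (x - p0.1) / (p1.1 - p0.1))%R) => y yc.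
rewrite /h/= [X in (_ * X)%R]z0E ?mulr0 ?mul0e//.
apply: contra yc; rewrite subr_eq0 => /eqP ->.
by rewrite mulfK// addrC subrK.
Qed.

Lemma negligible_degenerate : P.-negligible [set s | ~ nondeg (X^~ s)].
Proof.
pose A := [set s | gap (X^~ s) = 0%R].
pose B := [set s | gap (X^~ s) <> 0%R /\ det (X^~ s) = 0%R].
have m0 := mX i0; have m1 := mX i1; have m2 := mX i2.
have mg : measurable_fun setT (fun s => gap (X^~ s)) by rewrite /gap; mfun.
have md : measurable_fun setT (fun s => det (X^~ s)) by rewrite /det; mfun.
apply: (@negligibleS _ _ _ _ (A `|` B)).
  move=> s /= ns; have [|g0] := eqVneq (gap (X^~ s)) 0%R; first by left.
  right; split; first exact/eqP.
  by apply/eqP; apply: contra_notT ns => dd; exact: nondeg_of_generic.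
apply: negligibleU; apply/negligibleP => //.
- by rewrite -[A]setTI; apply: (mg measurableT [set 0%R]).
- rewrite (_ : B = (fun s => gap (X^~ s)) @^-1` (~` [set 0%R]) `&`
    (fun s => det (X^~ s)) @^-1` [set 0%R])//.
  by apply: measurableI; rewrite -[X in measurable X]setTI; [apply: (mg measurableT); exact: measurableC|apply: (md measurableT)].
Qed.

End nondegenerate.

(** * Haar invariance of the prior *)

Section haar.
Local Open Scope ereal_scope.
Context (R : realType) (n : nat).
Hypothesis n_gt0 : (0 < n)%N.
Notation mu := (@lebesgue_measure R).

Let u01 : R -> R := \1_`[0%R, 1%R]%classic.
Let u12 : R -> R := \1_`[1%R, 2%R]%classic.

Let u01_ge0 y : (0 <= u01 y)%R. Proof. by rewrite /u01 indicE. Qed.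
Let u12_ge0 y : (0 <= u12 y)%R. Proof. by rewrite /u12 indicE. Qed.

Let mu01 d (U : measurableType d) (g : U -> R) :
  measurable_fun setT g -> measurable_fun setT (fun u => u01 (g u)).
Proof. by move=> mg; apply: measurable_fun_indic. Qed.
Let mu12 d (U : measurableType d) (g : U -> R) :
  measurable_fun setT g -> measurable_fun setT (fun u => u12 (g u)).
Proof. by move=> mg; apply: measurable_fun_indic. Qed.

(* The weight [W]: the group element read off the sample lies in the box
   [0, 1]^3 x [1, 2]^2, which has finite positive Haar measure. *)
Definition boxw (x : 'I_n -> R * R) : R :=
  (u01 (mean2 x) * (u01 (mean1 x) * (u01 (slope x) *
    (u12 (sc2 x / sc1 x) * u12 (sc1 x * sc2 x)))))%R.

Lemma boxw_ge0 x : (0 <= boxw x)%R.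
Proof. by rewrite /boxw !mulr_ge0. Qed.

Lemma mfun_boxw d (U : measurableType d) (x : U -> 'I_n -> R * R) :
  (forall i, measurable_fun setT (fun u => x u i)) ->
  measurable_fun setT (fun u => boxw (x u)).
Proof.
move=> mx; have h1 := mfun_mean1 mx; have h2 := mfun_mean2 mx.
have h3 := mfun_slope mx; have h4 := mfun_sc1 mx; have h5 := mfun_sc2 mx.
rewrite /boxw; apply: mfun_M; first exact: mu01.
apply: mfun_M; first exact: mu01.
apply: mfun_M; first exact: mu01.
by apply: mfun_M; apply: mu12; mfun.
Qed.

Let int_indic_itv (x y : R) : (x < y)%R ->
  \int[mu]_z (\1_`[x, y]%classic z)%:E = (y - x)%:E.
Proof.
move=> xy; rewrite integral_indic// setIT.
transitivity (mu `[x, y]%classic) => //.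
by rewrite lebesgue_measure_itv/= lte_fin xy.
Qed.

Let int_u01 (c : R) : \int[mu]_x (u01 (x + c))%:E = 1.
Proof.
have m01 : measurable_fun setT (fun x => (u01 x)%:E) by apply: mfun_EFin; exact: mu01.
transitivity (\int[mu]_x (u01 (c + 1 * x))%:E).
  by apply: eq_integral => x _; rewrite mul1r addrC.
have u0 x : 0 <= (u01 x)%:E by rewrite lee_fin.
have := @integral_affine R 1 c _ ltr01 m01 u0.
rewrite mul1e => <-.
by rewrite int_indic_itv ?ltr01// subr0.
Qed.

Let int_Zu01 (k c : R) : (0 <= k)%R ->
  \int[mu]_x (k%:E * (u01 (x + c))%:E) = k%:E.
Proof.
move=> k0.
have m01 : measurable_fun setT (fun x : R => (u01 (x + c))%:E).
  by apply: mfun_EFin; apply: mu01; mfun.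
have h (x : R) : 0 <= (u01 (x + c))%:E by rewrite lee_fin.
by rewrite ge0_integralZl_EFin// int_u01 mule1.
Qed.

Let minv : measurable_fun setT (@GRing.inv R).
Proof. by apply: (@measurable_fun_inv _ _ R id); exact: measurable_id. Qed.

Let inv12 (t : R) : R := (u12 t * t^-1)%R.
Let minv12 : measurable_fun setT (fun t => (inv12 t)%:E).
Proof. by apply: mfun_EFin; apply: mfun_M; first exact: mu12. Qed.
Let inv12_ge0 t : (0 <= inv12 t)%R.
Proof.
rewrite /inv12 /u12 indicE; case: (boolP (t \in _)) => [/set_mem/=|_].
  by rewrite in_itv/= mul1r invr_ge0 => /andP[/(le_trans ler01)].
by rewrite mul0r.
Qed.

(** This is log 2, but only its positivity and finiteness are used. The measure dt / t is invariant
    under scaling, whence [k12_scale]. *)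
Let k12 := \int[mu]_t (inv12 t)%:E.

Let k12_scale (s : R) : (0 < s)%R ->
  \int[mu]_t (if (0 < t)%R then u12 (t * s) * t^-1 else 0)%:E = k12.
Proof.
move=> s0.
have i0 x : 0 <= (inv12 x)%:E by rewrite lee_fin.
rewrite /k12 (@integral_affine R s 0 _ s0 minv12 i0).
rewrite -ge0_integralZl_EFin ?ltW//; last first.
  by apply: (measurableT_comp minv12); mfun.
apply: eq_integral => t _; rewrite -EFinM add0r /inv12; congr (_%:E).
case: ifPn => [t0|]; first by rewrite (mulrC t); field; rewrite !lt0r_neq0.
rewrite -leNgt => t0; rewrite /u12 indicE memNset ?mul0r ?mulr0//=.
rewrite in_itv/= => /andP[h _].
have := lt_le_trans ltr01 h; rewrite pmulr_rgt0// ltNge t0//.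
Qed.

Let k12_gt0 : 0 < k12.
Proof.
have : 0 < \int[mu]_t ((2^-1)%:E * (u12 t)%:E).
  rewrite ge0_integralZl_EFin//; last 2 first.
  - by move=> x _; rewrite lee_fin.
  - by apply: mfun_EFin; exact: mu12.
  by rewrite int_indic_itv ?ltr1n// -EFinM lte_fin mulr_gt0// subr_gt0 ltr1n.
move=> /lt_le_trans; apply; apply: ge0_le_integral => //.
- by move=> x _; rewrite -EFinM lee_fin mulr_ge0.
- by apply: mfun_eM; [mfun|apply: mfun_EFin; exact: mu12].
- move=> x _; rewrite -EFinM lee_fin /inv12 /u12 indicE.
  case: (boolP (x \in _)) => [/set_mem/=|_]; last by rewrite mulr0 mul0r.
  rewrite in_itv/= mulr1 mul1r => /andP[x1 x2].
  by rewrite lef_pV2// posrE// (lt_le_trans ltr01).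
Qed.

Let k12_fin : k12 < +oo.
Proof.
apply: (@le_lt_trans _ _ (\int[mu]_t (u12 t)%:E)).
  apply: ge0_le_integral => //.
  - by move=> x _; rewrite lee_fin.
  - by apply: mfun_EFin; exact: mu12.
  - move=> x _; rewrite lee_fin /inv12 /u12 indicE.
    case: (boolP (x \in _)) => [/set_mem/=|_]; last by rewrite mul0r.
    rewrite in_itv/= mul1r => /andP[x1 x2].
    by rewrite invf_le1// (lt_le_trans ltr01).
by rewrite int_indic_itv ?ltr1n// ltry.
Qed.

Variable c : R.
Hypothesis c0 : (0 < c)%R.

(** The integrand, in the group element g, of the prior measure of those g for which g z falls into
    the box; the square roots recover the two scales of g from theta and eta. *)
Definition haar_box (z : 'I_n -> R * R) (m1 m2 b t e : R) : R :=
  if (0 < t)%R then if (0 < e)%R then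
    (c * (t * e)^-1 *
     boxw (fun i => act m1 m2 b (Num.sqrt (t / e)) (Num.sqrt (t * e)) (z i)))%R
  else 0%R else 0%R.

Lemma haar_box_ge0 z m1 m2 b t e : (0 <= haar_box z m1 m2 b t e)%R.
Proof.
rewrite /haar_box; case: ifP => // t0; case: ifP => // e0.
apply: mulr_ge0; last exact: boxw_ge0.
by apply: mulr_ge0; [exact: ltW|rewrite invr_ge0 ltW// mulr_gt0].
Qed.

Lemma mfun_haar_box d (U : measurableType d) (z : U -> 'I_n -> R * R)
    (m1 m2 b t e : U -> R) :
  (forall i, measurable_fun setT (fun u => z u i)) ->
  measurable_fun setT m1 -> measurable_fun setT m2 -> measurable_fun setT b ->
  measurable_fun setT t -> measurable_fun setT e ->
  measurable_fun setT (fun u => haar_box (z u) (m1 u) (m2 u) (b u) (t u) (e u)).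
Proof.
move=> mz *; rewrite /haar_box; do 2 apply: mfun_pos_if => //.
apply: mfun_M; first by mfun.
by apply: mfun_boxw => i; have mi := mz i; rewrite /act; mfun.
Qed.

Lemma sqrt_scales (t e : R) : (0 < t)%R -> (0 < e)%R ->
  [/\ (0 < Num.sqrt (t / e))%R, (0 < Num.sqrt (t * e))%R,
     (Num.sqrt (t / e) * Num.sqrt (t * e) = t)%R &
     (Num.sqrt (t * e) / Num.sqrt (t / e) = e)%R].
Proof.
move=> t0 e0.
have a0 : (0 < Num.sqrt (t / e))%R by rewrite sqrtr_gt0 divr_gt0.
have d0 : (0 < Num.sqrt (t * e))%R by rewrite sqrtr_gt0 mulr_gt0.
have tE : (Num.sqrt (t / e) * Num.sqrt (t * e) = t)%R.
  rewrite -sqrtrM ?divr_ge0 ?ltW// (_ : t / e * (t * e) = t ^+ 2)%R.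
    by rewrite sqrtr_sqr gtr0_norm.
  by field; rewrite lt0r_neq0.
have a2 : (Num.sqrt (t / e) ^+ 2 = t / e)%R by rewrite sqr_sqrtr// divr_ge0 ?ltW.
split=> //.
transitivity (Num.sqrt (t / e) * Num.sqrt (t * e) / Num.sqrt (t / e) ^+ 2)%R.
  by field; rewrite lt0r_neq0.
by rewrite tE a2; field; rewrite !lt0r_neq0.
Qed.

(** The group element of g z is g times that of z, so the integral measures a right translate of the
    box. Right invariance, checked coordinate by coordinate, removes the dependence on z. *)
Lemma int5_haar_box : exists kap : \bar R, [/\ 0 < kap, kap < +oo &
  forall z, nondeg z ->
    int5 (fun m1 m2 b t e => (haar_box z m1 m2 b t e)%:E) = kap].
Proof.
(* Each of the three unit intervals contributes 1, and each of the two scale coordinates contributes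
   [k12]. *)
exists (c%:E * (k12 * k12)); split.
- by rewrite mule_gt0 ?lte_fin// mule_gt0.
- by rewrite lte_mul_pinfty ?lee_fin ?ltW// lte_mul_pinfty ?ltW// ge0_fin_numE ?ltW.
move=> z nz; rewrite int5_haar_order; last 2 first.
- by move=> d U *; apply: mfun_EFin; apply: mfun_haar_box => // i; exact: measurable_cst.
- by move=> *; rewrite lee_fin haar_box_ge0.
have [z0 z1] := nz.
have s1 : (0 < sc1 z)%R by rewrite sqrtr_gt0.
have s2 : (0 < sc2 z)%R by rewrite sqrtr_gt0.
pose ft (t : R) : R := if (0 < t)%R then (u12 (t * (sc1 z * sc2 z)) * t^-1)%R else 0%R.
pose fe (e : R) : R := if (0 < e)%R then (u12 (e * (sc2 z / sc1 z)) * e^-1)%R else 0%R.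
have fe0 e : (0 <= fe e)%R.
  by rewrite /fe; case: ifP => // e0; rewrite mulr_ge0// invr_ge0 ltW.
have ft0 t : (0 <= ft t)%R.
  by rewrite /ft; case: ifP => // t0; rewrite mulr_ge0// invr_ge0 ltW.
have mfe : measurable_fun setT (fun e => (fe e)%:E).
  apply: mfun_EFin; rewrite /fe; apply: mfun_pos_if; first by mfun.
  by apply: mfun_M; [apply: mu12; mfun|mfun].
have mft : measurable_fun setT (fun t => (ft t)%:E).
  apply: mfun_EFin; rewrite /ft; apply: mfun_pos_if; first by mfun.
  by apply: mfun_M; [apply: mu12; mfun|mfun].
have inner t e : \int[mu]_b \int[mu]_m1 \int[mu]_m2 (haar_box z m1 m2 b t e)%:E =
    c%:E * (ft t)%:E * (fe e)%:E.
  rewrite /haar_box /ft /fe.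
  case: ifPn => t0; last first.
    by rewrite mule0 mul0e; do 3 (apply: integral0_eq => ? _).
  case: ifPn => e0; last first.
    by rewrite mule0; do 3 (apply: integral0_eq => ? _).
  have [a0 d0 tE eE] := sqrt_scales t0 e0.
  set a := Num.sqrt (t / e) in a0 tE eE *.
  set dd := Num.sqrt (t * e) in d0 tE eE *.
  pose C := (c * (t * e)^-1 * (u12 (e * (sc2 z / sc1 z)) * u12 (t * (sc1 z * sc2 z))))%R.
  have C0 : (0 <= C)%R.
    apply: mulr_ge0; last exact: mulr_ge0.
    by apply: mulr_ge0; [exact: ltW|rewrite invr_ge0 ltW// mulr_gt0].
  have E m1 m2 b : (c * (t * e)^-1 * boxw (fun i => act m1 m2 b a dd (z i)))%R =
      (C * u01 (b + e * slope z) * u01 (m1 + a * mean1 z) *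
        u01 (m2 + (b * a * mean1 z + dd * mean2 z)))%R.
    have xE i : act m1 m2 b a dd (z i) = (m1 + a * (z i).1, m2 + b * a * (z i).1 + dd * (z i).2)%R by [].
    rewrite /boxw (mean1_affine n_gt0 xE) (mean2_affine n_gt0 xE).
    rewrite (slope_affine n_gt0 a0 xE) ?lt0r_neq0//.
    rewrite (sc1_affine n_gt0 a0 xE) (sc2_affine n_gt0 a0 d0 xE) ?lt0r_neq0//.
    rewrite (_ : dd * sc2 z / (a * sc1 z) = e * (sc2 z / sc1 z))%R; last first.
      by rewrite -eE; field; rewrite !lt0r_neq0.
    rewrite (_ : a * sc1 z * (dd * sc2 z) = t * (sc1 z * sc2 z))%R; last first.
      by rewrite -tE; ring.
    by rewrite eE -(addrA m2) /C; ring.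
  transitivity (\int[mu]_b (C%:E * (u01 (b + e * slope z))%:E)).
    apply: eq_integral => b _.
    transitivity (\int[mu]_m1 ((C * u01 (b + e * slope z))%:E * (u01 (m1 + a * mean1 z))%:E)).
      apply: eq_integral => m1 _.
      transitivity (\int[mu]_m2 ((C * u01 (b + e * slope z) * u01 (m1 + a * mean1 z))%:E *
          (u01 (m2 + (b * a * mean1 z + dd * mean2 z)))%:E)).
        by apply: eq_integral => m2 _; rewrite E EFinM.
      rewrite int_Zu01; [by rewrite EFinM|by apply: mulr_ge0 => //; exact: mulr_ge0].
    rewrite int_Zu01; [by rewrite EFinM|exact: mulr_ge0].
  rewrite int_Zu01// -!EFinM /C; congr (_%:E).
  by field; rewrite !lt0r_neq0.
transitivity (\int[mu]_t ((c%:E * k12) * (ft t)%:E)).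
  apply: eq_integral => t _.
  transitivity (\int[mu]_e ((c * ft t)%:E * (fe e)%:E)).
    by apply: eq_integral => e _; rewrite inner EFinM.
  have h (x : R) : 0 <= (fe x)%:E by rewrite lee_fin.
  have k0 : (0 <= c * ft t)%R by rewrite mulr_ge0// ltW.
  rewrite ge0_integralZl_EFin//.
  by rewrite k12_scale ?divr_gt0// EFinM muleAC.
have h (x : R) : 0 <= (ft x)%:E by rewrite lee_fin.
have k0 : 0 <= c%:E * k12 by rewrite mule_ge0 ?lee_fin ?ltW.
rewrite ge0_integralZl//.
by rewrite k12_scale ?mulr_gt0// muleA.
Qed.

End haar.

(** * The law of the pivot *)

Section measurable_posterior.
Context (R : realType) (n : nat) (c : R).
Hypothesis c0 : 0 < c.

Lemma post_ge0 (x : 'I_n -> R * R) m1 m2 b t e : (0 <= post c x m1 m2 b t e)%E.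
Proof.
rewrite /post lee_fin; case: ifP => // t0; case: ifP => // e0.
apply: mulr_ge0; last by rewrite divr_ge0 ?ltW// mulr_gt0.
by apply: prodr_ge0 => i _; apply: ltW; apply: bvn_density_gt0.
Qed.

Lemma mfun_post d (U : measurableType d) (x : U -> 'I_n -> R * R)
    (m1 m2 b t e : U -> R) :
  (forall i, measurable_fun setT (fun u => x u i)) ->
  measurable_fun setT m1 -> measurable_fun setT m2 -> measurable_fun setT b ->
  measurable_fun setT t -> measurable_fun setT e ->
  measurable_fun setT (fun u => post c (x u) (m1 u) (m2 u) (b u) (t u) (e u)).
Proof.
move=> mx *; rewrite /post; apply: mfun_EFin; do 2 apply: mfun_pos_if => //.
by apply: mfun_M; [exact: mfun_likelihood|mfun].
Qed.

Lemma jm5_post (x : 'I_n -> R * R) : jm5 (post c x).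
Proof. by move=> d U *; apply: mfun_post => // i; exact: measurable_cst. Qed.

Lemma kern_ge0 m1 m2 b t e : (0 <= kern n m1 m2 b t e :> \bar R)%E.
Proof.
rewrite /kern lee_fin; case: ifP => // t0; case: ifP => // e0.
apply: mulr_ge0; last exact: expR_ge0.
by rewrite mulr_ge0 ?exprn_ge0 ?invr_ge0 ?ltW// mulr_gt0.
Qed.

Lemma jm5_kern : jm5 (kern n : R -> _).
Proof.
move=> d U *; rewrite /kern; apply: mfun_EFin; do 2 apply: mfun_pos_if => //.
by mfun.
Qed.

Lemma kconst_gt0 (x : 'I_n -> R * R) : nondeg x -> 0 < kconst c x.
Proof.
move=> [x0 x1]; have a0 : 0 < sc1 x by rewrite sqrtr_gt0.
have d0 : 0 < sc2 x by rewrite sqrtr_gt0.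
rewrite /kconst mulr_gt0 ?invr_gt0 ?exprn_gt0// mulr_gt0// exprn_gt0// invr_gt0.
by rewrite !mulr_gt0// pi_gt0.
Qed.

End measurable_posterior.

Section marginals.
Local Open Scope ereal_scope.
Context (R : realType).
Notation mu := (@lebesgue_measure R).

Lemma imarg_interest psi (g : R -> R) f v : (forall y, 0 <= g y)%R -> jm5 f ->
  (forall x y z t e, 0 <= f x y z t e) ->
  imarg psi (fun m1 m2 b t e =>
    (g (interest_val psi (Param m1 m2 b t e)))%:E * f m1 m2 b t e) v =
  (g v)%:E * imarg psi f v.
Proof.
move=> g0 mf f0.
transitivity (imarg psi (fun m1 m2 b t e => (g v)%:E * f m1 m2 b t e) v).
  by case: psi.
exact: imargZ.
Qed.

Lemma int5Z (k : R) f : (0 <= k)%R -> jm5 f -> (forall x y z t e, 0 <= f x y z t e) ->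
  int5 (fun x y z t e => k%:E * f x y z t e) = k%:E * int5 f.
Proof.
move=> k0 mf f0.
have mkf : jm5 (fun x y z t e => k%:E * f x y z t e).
  by move=> d U *; apply: mfun_eM; [exact: measurable_cst|exact: mf].
have kf0 x y z t e : 0 <= k%:E * f x y z t e by rewrite mule_ge0.
rewrite (int5_imarg Theta mkf kf0) (int5_imarg Theta mf f0).
have mi : measurable_fun setT (imarg Theta f) by exact: measurable_imarg.
have i0 v : 0 <= imarg Theta f v by exact: imarg_ge0.
rewrite -ge0_integralZl_EFin//.
by apply: eq_integral => v _; exact: imargZ.
Qed.

Lemma imarg_post psi n (c : R) (x : 'I_n -> R * R) v : (0 < n)%N -> (0 < c)%R ->
  nondeg x ->
  imarg psi (post c x) (iloc psi (slope x) + iscale psi (sc1 x) (sc2 x) * v)%R =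
  (sc2 x ^+ 4 / iscale psi (sc1 x) (sc2 x) * kconst c x)%:E * imarg psi (kern n) v.
Proof.
move=> n0 c0 nx; have [x0 x1] := nx.
have a0 : (0 < sc1 x)%R by rewrite sqrtr_gt0.
have d0 : (0 < sc2 x)%R by rewrite sqrtr_gt0.
rewrite (imarg_triangular psi (mean1 x) (mean2 x) (slope x) _ a0 d0 (jm5_post c x));
  last by move=> *; exact: post_ge0.
rewrite (EFinM _ (kconst c x)) -muleA; congr (_ * _).
transitivity (imarg psi (fun m1 m2 b t e => (kconst c x)%:E * kern n m1 m2 b t e) v).
  congr (imarg psi _ v); do 5 apply/funext => ?; exact: post_triangular.
apply: imargZ; [by rewrite ltW// kconst_gt0|exact: jm5_kern|].
by move=> *; exact: kern_ge0.
Qed.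

(** Integrating over the coordinate of interest restores the scale that was divided out, so the
    factor depends neither on [psi] nor on [h]. *)
Lemma integral_imarg_post psi n (c : R) (x : 'I_n -> R * R) (h : R -> \bar R) :
  (0 < n)%N -> (0 < c)%R -> nondeg x ->
  measurable_fun setT h -> (forall y, 0 <= h y) ->
  \int[mu]_v (h v * imarg psi (post c x) v) =
  (sc2 x ^+ 4 * kconst c x)%:E *
  \int[mu]_v (h (iloc psi (slope x) + iscale psi (sc1 x) (sc2 x) * v)%R * imarg psi (kern n) v).
Proof.
move=> n0 c0 nx mh h0; have [x0 x1] := nx.
have a0 : (0 < sc1 x)%R by rewrite sqrtr_gt0.
have d0 : (0 < sc2 x)%R by rewrite sqrtr_gt0.
have s0 := iscale_gt0 psi a0 d0.
have k0 := kconst_gt0 c0 nx.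
have mk : measurable_fun setT (imarg psi (kern n : R -> _)).
  by apply: measurable_imarg; [exact: jm5_kern|move=> *; exact: kern_ge0].
have mp : measurable_fun setT (imarg psi (post c x)).
  by apply: measurable_imarg; [exact: jm5_post|move=> *; exact: post_ge0].
have ip0 v : 0 <= imarg psi (post c x) v by apply: imarg_ge0 => *; exact: post_ge0.
have ik0 v : 0 <= imarg psi (kern n : R -> _) v by apply: imarg_ge0 => *; exact: kern_ge0.
have mF : measurable_fun setT (fun v => h v * imarg psi (post c x) v) by exact: mfun_eM.
have F0 v : 0 <= h v * imarg psi (post c x) v by rewrite mule_ge0.
apply: etrans; first exact: (@integral_affine R _ (iloc psi (slope x)) _ s0 mF F0).
have kk0 : (0 <= sc2 x ^+ 4 / iscale psi (sc1 x) (sc2 x) * kconst c x)%R.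
  by rewrite mulr_ge0 ?ltW// divr_gt0// exprn_gt0.
transitivity ((iscale psi (sc1 x) (sc2 x))%:E *
  ((sc2 x ^+ 4 / iscale psi (sc1 x) (sc2 x) * kconst c x)%:E *
  \int[mu]_v (h (iloc psi (slope x) + iscale psi (sc1 x) (sc2 x) * v)%R * imarg psi (kern n) v))).
  have mhk : measurable_fun setT (fun v => h (iloc psi (slope x) +
      iscale psi (sc1 x) (sc2 x) * v)%R * imarg psi (kern n) v).
    by apply: mfun_eM; [apply: (measurableT_comp mh); mfun|exact: mk].
  have hk0 v : 0 <= h (iloc psi (slope x) + iscale psi (sc1 x) (sc2 x) * v)%R *
      imarg psi (kern n) v by rewrite mule_ge0.
  congr (_ * _).
  apply: etrans; last first.
    by apply: (ge0_integralZl_EFin mu measurableT _ mhk kk0) => v _; exact: hk0.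
  apply: eq_integral => v _.
  by apply: etrans; [apply: congr1; exact: imarg_post|exact: muleCA].
rewrite muleA -EFinM; congr (_%:E * _).
by field; rewrite lt0r_neq0.
Qed.

End marginals.

Section pivot_law.
Local Open Scope ereal_scope.
Context (R : realType) (n : nat) d (T : measurableType d) (P : probability T R).
Variables (X : 'I_n -> T -> R * R) (m1 m2 b a dd c : R) (psi : interest).
Hypothesis n3 : (3 <= n)%N.
Hypothesis a0 : (0 < a)%R.
Hypothesis d0 : (0 < dd)%R.
Hypothesis c0 : (0 < c)%R.
Let w := Param m1 m2 b (a * dd) (dd / a).
Hypothesis iidX : iid_density P X (bvn_density w).
Notation mu := (@lebesgue_measure R).

Let n0 : (0 < n)%N. Proof. exact: leq_trans n3. Qed.
Let mX i : measurable_fun setT (X i). Proof. by case: iidX. Qed.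
Let valid_w : valid_param w. Proof. by split => /=; [exact: mulr_gt0|exact: divr_gt0]. Qed.
Let mw : measurable_fun setT (bvn_density w).
Proof. by rewrite /bvn_density/=; mfun. Qed.
Let w0 z : (0 <= bvn_density w z)%R. Proof. by apply: ltW; exact: bvn_density_gt0. Qed.

Let Z s i := invact m1 m2 b a dd (X i s).
Let Y s := pivot psi (interest_val psi w) (X^~ s).

Let mZ i : measurable_fun setT (fun s => Z s i).
Proof. by have mi := mX i; rewrite /Z /invact; mfun. Qed.
Let mY : measurable_fun setT Y.
Proof. by apply: mfun_pivot; [exact: mX|mfun]. Qed.

Let XZ s i : X i s = (m1 + a * (Z s i).1, m2 + b * a * (Z s i).1 + dd * (Z s i).2)%R.
Proof. by rewrite -[LHS](invactK m1 m2 b _ a0 d0). Qed.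

Let nondegZ s : nondeg (X^~ s) -> nondeg (Z s).
Proof. by move/(nondeg_affine n0 a0 d0 (XZ s)). Qed.

Let Y_act s m1' m2' b' a' d' : (0 < a')%R -> (0 < d')%R -> nondeg (X^~ s) ->
  pivot psi (interest_val psi (Param m1' m2' b' (a' * d') (d' / a')))
    (fun i => act m1' m2' b' a' d' (Z s i)) = Y s.
Proof.
move=> a'0 d'0 /nondegZ nz.
rewrite (pivot_affine n0 a'0 d'0 (fun i => erefl : act m1' m2' b' a' d' (Z s i) = _) psi nz).
by rewrite /Y /w (pivot_affine n0 a0 d0 (XZ s) psi nz).
Qed.

Lemma ae_nondeg (f g : T -> \bar R) : measurable_fun setT f -> measurable_fun setT g ->
  (forall s, 0 <= f s) -> (forall s, 0 <= g s) ->
  (forall s, nondeg (X^~ s) -> f s = g s) -> \int[P]_s f s = \int[P]_s g s.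
Proof.
move=> mf mg f0 g0 fg; apply: ge0_ae_eq_integral => //.
apply: negligibleS (negligible_degenerate mw w0 iidX n3) => s /= h1 h2.
by apply: h1 => _; exact: fg.
Qed.

Let lik s := likelihood (X^~ s) w.
Let lik_gt0 s : (0 < lik s)%R.
Proof. by apply: prodr_gt0 => i _; exact: bvn_density_gt0. Qed.
Let mlik : measurable_fun setT lik.
Proof. by apply: mfun_likelihood => //; mfun. Qed.

(** Only [kap] is known to be finite here: [C0] and the total mass of the kernel may still be
    infinite. Both constants are fixed before [A], which is what makes the case of the whole line
    informative. *)
Lemma pivot_law : exists kap C0 : \bar R, [/\ 0 < kap, kap < +oo, 0 <= C0 &
  forall A, measurable A ->
    kap * P (Y @^-1` A) = C0 * \int[mu]_v ((\1_A v)%:E * imarg psi (kern n) v)].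
Proof.
have [kap [kap0 kapoo kapE]] := @int5_haar_box R n n0 c c0.
have kapfin : kap \is a fin_num by rewrite ge0_fin_numE ?ltW.
(* Dividing by the likelihood at the true parameter turns [P] into Lebesgue measure on samples;
   [boxw] is the weight W. *)
pose wt s : R := (boxw (X^~ s) / lik s)%R.
have wt0 s : (0 <= wt s)%R by rewrite /wt divr_ge0 ?boxw_ge0// ltW.
have mwt : measurable_fun setT wt.
  by have mb := mfun_boxw mX; rewrite /wt; mfun.
pose cst s : R := if (0 < ss11 (X^~ s))%R then if (0 < resid (X^~ s))%R then
  (sc2 (X^~ s) ^+ 4 * kconst c (X^~ s))%R else 0%R else 0%R.
have cstE s : nondeg (X^~ s) -> cst s = (sc2 (X^~ s) ^+ 4 * kconst c (X^~ s))%R.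
  by move=> [h1 h2]; rewrite /cst h1 h2.
have cst0 s : (0 <= cst s)%R.
  rewrite /cst; case: ifP => // h1; case: ifP => // h2.
  by rewrite mulr_ge0 ?exprn_ge0 ?sqrtr_ge0// ltW// kconst_gt0.
have mcst : measurable_fun setT cst.
  have h1 := mfun_sc1 mX; have h2 := mfun_sc2 mX.
  have h3 := mfun_ss11 mX; have h4 := mfun_resid mX.
  by rewrite /cst /kconst; do 2 apply: mfun_pos_if => //; mfun.
pose C0 := \int[P]_s (wt s * cst s)%:E.
exists kap, C0; split => //.
  by apply: integral_ge0 => s _; rewrite lee_fin mulr_ge0.
move=> A mA.
have iA0 y : (0 <= \1_A y :> R)%R by rewrite indicE.
(* [K1] is the integrand after the substitution, where the pivot no longer involves the parameter;
   [K2] is the one before it, where the posterior appears. *)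
pose K1 s x y z t e := (\1_A (Y s) : R)%:E * (haar_box c (Z s) x y z t e)%:E.
pose K2 s x y z t e := (wt s)%:E *
  ((\1_A (pivot psi (interest_val psi (Param x y z t e)) (X^~ s)) : R)%:E *
  post c (X^~ s) x y z t e).
have K10 s x y z t e : 0 <= K1 s x y z t e.
  by rewrite mule_ge0 ?lee_fin// haar_box_ge0.
have K20 s x y z t e : 0 <= K2 s x y z t e.
  apply: mule_ge0; first by rewrite lee_fin.
  by apply: mule_ge0; [rewrite lee_fin|exact: post_ge0].
have mK1 : jmeas6 K1.
  move=> d' U s x y z t e ms mx my mz mt me; apply: mfun_eM; apply: mfun_EFin.
    by apply: measurable_fun_indic => //; apply: (measurableT_comp mY).
  by apply: mfun_haar_box => // i; apply: (measurableT_comp (mZ i)).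
have mK2 : jmeas6 K2.
  move=> d' U s x y z t e ms mx my mz mt me; apply: mfun_eM.
    by apply: mfun_EFin; apply: (measurableT_comp mwt).
  have mXs i : measurable_fun setT (fun u => X i (s u)) by apply: (measurableT_comp (mX i)).
  apply: mfun_eM; last exact: mfun_post.
  apply: mfun_EFin; apply: measurable_fun_indic => //; apply: mfun_pivot => //.
  by case: psi.
have E1 : \int[P]_s int5 (K1 s) = kap * P (Y @^-1` A).
  transitivity (\int[P]_s (kap * (\1_A (Y s))%:E)).
    apply: ae_nondeg => //.
    - by do 5 (apply: mfun_int => [|*]; last by do ?[apply: integral_ge0 => *]); apply: mK1; mfun.
    - by apply: mfun_eM => //; apply: mfun_EFin; exact: measurable_fun_indic.
    - by move=> s; exact: int5_ge0.
    - by move=> s; apply: mule_ge0; [exact: ltW|rewrite lee_fin].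
    move=> s ns; rewrite /K1 int5Z ?kapE//; [by rewrite muleC|exact: nondegZ| |].
      by move=> d' U *; apply: mfun_EFin; apply: mfun_haar_box => // i; exact: measurable_cst.
    by move=> *; rewrite lee_fin haar_box_ge0.
  have mAY : measurable_fun setT (fun s => (\1_A (Y s) : R)%:E).
    by apply: mfun_EFin; exact: measurable_fun_indic.
  have AY0 s : 0 <= (\1_A (Y s) : R)%:E by rewrite lee_fin.
  rewrite ge0_integralZl ?ltW//.
  congr (_ * _); rewrite -[X in _ = P X]setIT -integral_indic//.
  by rewrite -[X in measurable X]setTI; exact: mY.
rewrite -E1 (pull5 P mK1 K10).
(* For each fixed parameter this is the substitution on the sample; outside positive [t] and [e]
   both integrands vanish. *)
have E2 : int5 (fun x y z t e => \int[P]_s K1 s x y z t e) =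
    int5 (fun x y z t e => \int[P]_s K2 s x y z t e).
  congr int5; apply/funext => x; apply/funext => y; apply/funext => z.
  apply/funext => t; apply/funext => e.
  have [t0|t0] := ltP 0%R t; last first.
    rewrite !integral0_eq// => s _; rewrite /K1 /K2 /haar_box /post ltNge t0/= ?mule0//.
  have [e0|e0] := ltP 0%R e; last first.
    rewrite !integral0_eq// => s _; rewrite /K1 /K2 /haar_box /post t0 ltNge e0/= ?mule0//.
  have [a'0 d'0 tE eE] := sqrt_scales t0 e0.
  pose F (u : 'I_n -> R * R) := (c * (t * e)^-1 * boxw u *
    \1_A (pivot psi (interest_val psi (Param x y z t e)) u))%:E.
  have cte : (0 <= c * (t * e)^-1)%R by rewrite divr_ge0 ?ltW// mulr_gt0.
  have F0 u : 0 <= F u by rewrite lee_fin mulr_ge0// mulr_ge0// boxw_ge0.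
  have mF : smeas F.
    have mt j : measurable_fun setT (fun t : n.-tuple (R * R)%type => tnth t j).
      exact: measurable_tnth.
    apply: mfun_EFin; apply: mfun_M.
      by apply: mfun_M; [exact: measurable_cst|exact: mfun_boxw].
    by apply: measurable_fun_indic => //; apply: mfun_pivot => //; exact: measurable_cst.
  have := change_of_sample a0 d0 iidX x y z a'0 d'0 mF F0.
  rewrite tE eE => H.
  transitivity (\int[P]_s F (fun j => act x y z (Num.sqrt (t / e)) (Num.sqrt (t * e)) (Z s j))).
    apply: ae_nondeg => //.
    - by apply: mK1; mfun.
    - apply: (smeas_comp mF) => j; have mj := mZ j; rewrite /act; mfun.
    move=> s ns; rewrite /K1 /F /haar_box t0 e0 -EFinM; congr (_%:E).
    have HY := Y_act x y z a'0 d'0 ns; rewrite tE eE in HY.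
    by rewrite HY mulrC.
  rewrite -H; apply: eq_integral => s _.
  rewrite /F /K2 /post t0 e0 -!EFinM /wt -/(lik s); congr (_%:E).
  by ring.
(* With the sample fixed, the parameter is now integrated first, which produces the posterior
   marginal of the coordinate of interest. *)
rewrite E2 -(pull5 P mK2 K20).
pose UA := \int[mu]_v ((\1_A v)%:E * imarg psi (kern n) v).
have mk : measurable_fun setT (imarg psi (kern n : R -> _)).
  by apply: measurable_imarg; [exact: jm5_kern|move=> *; exact: kern_ge0].
have UA0 : 0 <= UA.
  apply: integral_ge0 => v _; apply: mule_ge0; first by rewrite lee_fin.
  by apply: imarg_ge0 => *; exact: kern_ge0.
have mC : measurable_fun setT (fun s => (wt s * cst s)%:E) by apply: mfun_EFin; mfun.
transitivity (\int[P]_s ((wt s * cst s)%:E * UA)); last first.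
  apply: (ge0_integralZr P measurableT mC _ UA0) => s _.
  by rewrite lee_fin mulr_ge0.
apply: ae_nondeg.
- by do 5 (apply: mfun_int => [|*]; last by do ?[apply: integral_ge0 => *]); apply: mK2; mfun.
- by apply: mfun_eM; [exact: mC|exact: measurable_cst].
- by move=> s; exact: int5_ge0.
- by move=> s; apply: mule_ge0; [rewrite lee_fin mulr_ge0|exact: UA0].
move=> s ns.
pose g v : R := \1_A (pivot psi v (X^~ s)).
have g0 v : (0 <= g v)%R by rewrite /g.
have mg : measurable_fun setT g.
  apply: measurable_fun_indic; first exact: mA.
  by apply: mfun_pivot; [move=> i; exact: measurable_cst|exact: measurable_id].
have mgp : jm5 (fun x y z t e => (g (interest_val psi (Param x y z t e)))%:E *
    post c (X^~ s) x y z t e).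
  move=> d' U *; apply: mfun_eM; last exact: jm5_post.
  by apply: mfun_EFin; apply: (measurableT_comp mg); case: psi.
have gp0 x y z t e : 0 <= (g (interest_val psi (Param x y z t e)))%:E *
    post c (X^~ s) x y z t e by apply: mule_ge0; [rewrite lee_fin|exact: post_ge0].
apply: etrans; first exact: (int5Z (wt0 s) mgp gp0).
rewrite [in RHS]EFinM -[in RHS]muleA; congr (_ * _).
apply: etrans; first exact: (int5_imarg psi mgp gp0).
transitivity (\int[mu]_v ((g v)%:E * imarg psi (post c (X^~ s)) v)).
  apply: eq_integral => v _.
  apply: (imarg_interest psi v g0 (jm5_post c (X^~ s))).
  by move=> *; exact: post_ge0.
have mEg : measurable_fun setT (EFin \o g) by exact/measurable_EFinP.
apply: etrans.
  by apply: (integral_imarg_post psi n0 c0 ns mEg) => v; rewrite lee_fin.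
rewrite (cstE s ns); apply: congr1; apply: eq_integral => v _.
apply: (congr1 (mule^~ _)); rewrite /= /g /pivot; congr (_%:E); congr (\1_A _).
have [h1 h2] := ns.
have s0 : (0 < iscale psi (sc1 (X^~ s)) (sc2 (X^~ s)))%R.
  by apply: iscale_gt0; rewrite sqrtr_gt0.
have E (l k : R) : (k != 0 -> (l + k * v - l) / k = v)%R by move=> kn0; field.
exact: (E _ _ (lt0r_neq0 s0)).
Qed.

End pivot_law.

(** * Posterior and coverage *)

Section posterior.
Local Open Scope ereal_scope.
Context (R : realType) (n : nat) (c : R) (psi : interest).
Hypothesis n0 : (0 < n)%N.
Hypothesis c0 : (0 < c)%R.
Notation mu := (@lebesgue_measure R).
Let prior (w : param R) : R := (c * (p_theta w * p_eta w)^-1)%R.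
Implicit Type x : 'I_n -> R * R.

Lemma integral_pos (f : R -> \bar R) :
  \int[mu]_(t in `]0%R, +oo[) f t = \int[mu]_t (if (0 < t)%R then f t else 0).
Proof.
rewrite integral_mkcond; apply: eq_integral => t _.
by rewrite /patch mem_setE/= in_itv/= andbT.
Qed.

Lemma evidenceE x : evidence prior x = int5 (post c x).
Proof.
rewrite /evidence /int5; apply: eq_integral => m1 _; apply: eq_integral => m2 _.
apply: eq_integral => b _; apply: etrans; first exact: integral_pos.
apply: eq_integral => t _; rewrite /post; case: ifPn => t0.
  apply: etrans; first exact: integral_pos.
  by apply: eq_integral => e _; case: ifPn.
by apply: esym; apply: integral0_eq.
Qed.

Let ev_inv_ge0 x : (0 <= (fine (evidence prior x))^-1)%R.
Proof.
rewrite invr_ge0 fine_ge0// evidenceE; apply: int5_ge0 => *; exact: post_ge0.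
Qed.

Lemma marginal_densityE x v : interest_range psi v ->
  marginal_density psi prior x v =
  ((fine (evidence prior x))^-1)%:E * imarg psi (post c x) v.
Proof.
move=> rv; rewrite -(imargZ psi v (ev_inv_ge0 x) (jm5_post c x)); last first.
  by move=> *; exact: post_ge0.
case: psi rv => /= rv.
- apply: eq_integral => m1 _; apply: eq_integral => m2 _.
  apply: etrans; first exact: integral_pos.
  apply: eq_integral => t _; rewrite /post; case: ifPn => t0; last first.
    by apply: esym; apply: integral0_eq => e _; rewrite mule0.
  apply: etrans; first exact: integral_pos.
  apply: eq_integral => e _; case: ifPn => e0; last by rewrite mule0.
  by rewrite -EFinM /posterior_density mulrC.
- move: rv; rewrite in_itv/= andbT => v0.
  apply: eq_integral => m1 _; apply: eq_integral => m2 _; apply: eq_integral => b _.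
  apply: etrans; first exact: integral_pos.
  apply: eq_integral => e _; rewrite /post v0; case: ifPn => e0; last by rewrite mule0.
  by rewrite -EFinM /posterior_density mulrC.
- move: rv; rewrite in_itv/= andbT => v0.
  apply: eq_integral => m1 _; apply: eq_integral => m2 _; apply: eq_integral => b _.
  apply: etrans; first exact: integral_pos.
  apply: eq_integral => t _; rewrite /post v0; case: ifPn => t0; last by rewrite mule0.
  by rewrite -EFinM /posterior_density mulrC.
Qed.

Lemma imarg_post_out x v : ~ interest_range psi v -> imarg psi (post c x) v = 0.
Proof.
case: psi => /=; first by move=> /(_ I).
- rewrite in_itv/= andbT => /negP/negPf v0.
  by do 4 (apply: integral0_eq => ? _); rewrite /post v0.
- rewrite in_itv/= andbT => /negP/negPf v0.
  by do 4 (apply: integral0_eq => ? _); rewrite /post v0; case: ifP.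
Qed.

Let mk : R -> \bar R := imarg psi (kern n : R -> _).
Let Q : \bar R := \int[mu]_v mk v.
Hypothesis Q0 : 0 < Q.
Hypothesis Qoo : Q < +oo.

Lemma mfun_mk : measurable_fun setT mk.
Proof. by apply: measurable_imarg; [exact: jm5_kern|move=> *; exact: kern_ge0]. Qed.

Lemma mk_ge0 v : 0 <= mk v.
Proof. by apply: imarg_ge0 => *; exact: kern_ge0. Qed.

Let Qfin : Q \is a fin_num. Proof. by rewrite ge0_fin_numE// ltW. Qed.
Let fQ0 : (0 < fine Q)%R. Proof. by rewrite fine_gt0// Q0. Qed.

Lemma evidence_nondeg x : nondeg x ->
  evidence prior x = (sc2 x ^+ 4 * kconst c x)%:E * Q.
Proof.
move=> nx; rewrite evidenceE.
apply: etrans.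
  by apply: (int5_imarg psi (jm5_post c x)) => *; exact: post_ge0.
transitivity (\int[mu]_v (cst 1 v * imarg psi (post c x) v)).
  by apply: eq_integral => v _; rewrite mul1e.
apply: etrans; first by apply: (integral_imarg_post psi n0 c0 nx) => // y; exact: lee01.
by apply: congr1; apply: eq_integral => v _; rewrite mul1e.
Qed.

Let ec0 x : nondeg x -> (0 < sc2 x ^+ 4 * kconst c x)%R.
Proof.
move=> nx; have [x0 x1] := nx.
by rewrite mulr_gt0 ?exprn_gt0 ?sqrtr_gt0// kconst_gt0.
Qed.

Lemma proper_nondeg x : nondeg x -> proper_posterior prior x.
Proof.
move=> nx; rewrite /proper_posterior evidence_nondeg//; split.
  by rewrite mule_gt0 ?lte_fin// ec0.
by rewrite lte_mul_pinfty// lee_fin ltW// ec0.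
Qed.

Let g (v : R) : \bar R := ((fine Q)^-1)%:E * mk v.

Lemma marginal_density_pivot x v : nondeg x ->
  ((fine (evidence prior x))^-1)%:E *
    imarg psi (post c x) (iloc psi (slope x) + iscale psi (sc1 x) (sc2 x) * v)%R =
  ((iscale psi (sc1 x) (sc2 x))^-1)%:E * g v.
Proof.
move=> nx; have [x0 x1] := nx.
have s0 : (0 < iscale psi (sc1 x) (sc2 x))%R by rewrite iscale_gt0// sqrtr_gt0.
have e0 := ec0 nx.
rewrite (imarg_post psi v n0 c0 nx) /g !muleA -!EFinM; congr (_%:E * _).
rewrite evidence_nondeg// -(fineK Qfin) -EFinM /=.
have d0 : (0 < sc2 x)%R by rewrite sqrtr_gt0.
have k0 := kconst_gt0 c0 nx.
by field; rewrite !lt0r_neq0.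
Qed.

(** In the pivot coordinate the marginal density is [g] divided by the scale, so the cutoff [k]
    becomes a level of [g] multiplied by [iscale], still depending on the sample. *)
Lemma posterior_prob_hpd x (k : R) : nondeg x ->
  posterior_prob psi prior x (hpd_set psi prior x k) =
  ((fine Q)^-1)%:E *
  \int[mu]_v ((\1_[set u : R | ((iscale psi (sc1 x) (sc2 x) * k)%:E <= g u)%E] v)%:E * mk v).
Proof.
move=> nx; have [x0 x1] := nx.
have s0 : (0 < iscale psi (sc1 x) (sc2 x))%R by rewrite iscale_gt0// sqrtr_gt0.
have e0 := ec0 nx.
pose E := ((fine (evidence prior x))^-1)%R.
pose B := [set v | k%:E <= E%:E * imarg psi (post c x) v].
have mp : measurable_fun setT (imarg psi (post c x)).
  by apply: measurable_imarg; [exact: jm5_post|move=> *; exact: post_ge0].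
have ip0 v : 0 <= imarg psi (post c x) v by apply: imarg_ge0 => *; exact: post_ge0.
have mEp : measurable_fun setT (fun v => E%:E * imarg psi (post c x) v).
  by apply: mfun_eM; [exact: measurable_cst|exact: mp].
have mB : measurable B.
  by rewrite -[B]setTI; exact: emeasurable_fun_c_infty.
pose h v := (\1_B v : R)%:E.
have mh : measurable_fun setT h by apply: mfun_EFin; exact: measurable_indic.
have h0 v : 0 <= h v by rewrite lee_fin indicE.
have mhp : measurable_fun setT (fun v => h v * imarg psi (post c x) v).
  by apply: mfun_eM; [exact: mh|exact: mp].
have hp0 v : 0 <= h v * imarg psi (post c x) v by apply: mule_ge0.
transitivity (\int[mu]_v (E%:E * (h v * imarg psi (post c x) v))).
  rewrite /posterior_prob integral_mkcond; apply: eq_integral => v _.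
  rewrite /patch; have [rv|rv] := pselect (interest_range psi v); last first.
    rewrite memNset; last by move=> [_].
    by rewrite (imarg_post_out _ rv) !mule0.
  have -> : (v \in hpd_set psi prior x k `&` interest_range psi) = (v \in B).
    apply/idP/idP => /set_mem H; apply/mem_set.
      by case: H => -[_]; rewrite (marginal_densityE x rv).
    by split => //; split => //; rewrite (marginal_densityE x rv).
  rewrite /h indicE; case: ifPn => _ /=; last by rewrite mul0e mule0.
  by rewrite mul1e (marginal_densityE x rv).
have E0 : (0 <= E)%R by exact: ev_inv_ge0.
apply: etrans.
  by apply: (ge0_integralZl_EFin mu measurableT _ mhp E0) => v _; exact: hp0.
apply: etrans.
  by apply: congr1; apply: (integral_imarg_post psi n0 c0 nx mh h0).
have EK : (E * (sc2 x ^+ 4 * kconst c x) = (fine Q)^-1)%R.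
  rewrite /E evidence_nondeg// -(fineK Qfin) -EFinM /=.
  have d0 : (0 < sc2 x)%R by rewrite sqrtr_gt0.
  have k0 := kconst_gt0 c0 nx.
  by field; rewrite !lt0r_neq0.
rewrite muleA -EFinM EK; apply: congr1.
apply: eq_integral => v _; apply: (congr1 (mule^~ _)).
have iE (A : set R) y : (\1_A y : R)%:E = ((y \in A)%:R : R)%:E by rewrite indicE.
have hE y : h y = ((y \in B)%:R : R)%:E by exact: iE.
refine (etrans (hE _) (etrans _ (esym (iE _ _)))).
apply: (congr1 (fun q : bool => (q%:R : R)%:E)).
have BE : B (iloc psi (slope x) + iscale psi (sc1 x) (sc2 x) * v)%R <->
    ((iscale psi (sc1 x) (sc2 x) * k)%:E <= g v).
  by rewrite /B /= /E (marginal_density_pivot v nx) lee_pdivlMl// EFinM.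
apply/idP/idP => /set_mem H; apply/mem_set.
  exact: (BE.1 H).
exact: (BE.2 H).
Qed.

End posterior.

Section coverage.
Local Open Scope ereal_scope.
Context (R : realType) (n : nat) d (T : measurableType d) (P : probability T R).
Variables (X : 'I_n -> T -> R * R) (m1 m2 b a dd c : R) (psi : interest).
Hypothesis n3 : (3 <= n)%N.
Hypothesis a0 : (0 < a)%R.
Hypothesis d0 : (0 < dd)%R.
Hypothesis c0 : (0 < c)%R.
Let w := Param m1 m2 b (a * dd) (dd / a).
Hypothesis iidX : iid_density P X (bvn_density w).
Notation mu := (@lebesgue_measure R).
Let prior (w : param R) : R := (c * (p_theta w * p_eta w)^-1)%R.

Let n0 : (0 < n)%N. Proof. exact: leq_trans n3. Qed.
Let mX i : measurable_fun setT (X i). Proof. by case: iidX. Qed.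
Let valid_w : valid_param w. Proof. by split => /=; [exact: mulr_gt0|exact: divr_gt0]. Qed.
Let mw : measurable_fun setT (bvn_density w).
Proof. by rewrite /bvn_density/=; mfun. Qed.
Let w0 z : (0 <= bvn_density w z)%R. Proof. by apply: ltW; exact: bvn_density_gt0. Qed.

Let Y s := pivot psi (interest_val psi w) (X^~ s).
Let mY : measurable_fun setT Y.
Proof. by apply: mfun_pivot; [exact: mX|mfun]. Qed.

Let mk : R -> \bar R := imarg psi (kern n : R -> _).
Let Q : \bar R := \int[mu]_v mk v.

(** The whole line as [A] gives [kap] = [C0] * [Q]. As [kap] is positive and finite, neither factor
    can be 0 or infinite: the posterior turns out to be proper without its normalizing integral
    being evaluated. *)
Lemma pivot_law_normalized : [/\ 0 < Q, Q < +oo &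
  forall A, measurable A ->
    P (Y @^-1` A) = ((fine Q)^-1)%:E * \int[mu]_v ((\1_A v)%:E * mk v)].
Proof.
have [kap [C0 [kap0 kapoo C00 H]]] := @pivot_law R n d T P X m1 m2 b a dd c psi n3 a0 d0 c0 iidX.
have Qge0 : 0 <= Q by apply: integral_ge0 => v _; exact: mk_ge0.
have kapE : kap = C0 * Q.
  have := H setT measurableT; rewrite preimage_setT probability_setT mule1 => ->.
  by apply: congr1; apply: eq_integral => v _; rewrite indicT mul1e.
have Qn0 : Q != 0 by apply/eqP => Q0; move: kap0; rewrite kapE Q0 mule0 ltxx.
have C0n0 : C0 != 0 by apply/eqP => Q0; move: kap0; rewrite kapE Q0 mul0e ltxx.
have Qgt0 : 0 < Q by rewrite lt_neqAle eq_sym Qn0.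
have C0gt0 : 0 < C0 by rewrite lt_neqAle eq_sym C0n0.
have Qoo : Q < +oo.
  by rewrite ltey; apply/eqP => Q0; move: kapoo; rewrite kapE Q0 gt0_muley// ltxx.
have C0oo : C0 < +oo.
  by rewrite ltey; apply/eqP => Q0; move: kapoo; rewrite kapE Q0 gt0_mulye// ltxx.
split=> // A mA.
have Qfin : Q \is a fin_num by rewrite ge0_fin_numE.
have C0fin : C0 \is a fin_num by rewrite ge0_fin_numE.
have q0 : (0 < fine Q)%R by rewrite fine_gt0// Qgt0.
have r0 : (0 < fine C0)%R by rewrite fine_gt0// C0gt0.
have := H A mA; rewrite kapE -(fineK Qfin) -(fineK C0fin) => E.
set I := \int[mu]_v _ in E *.
transitivity (((fine Q)^-1 * (fine C0)^-1)%:E * ((fine C0)%:E * (fine Q)%:E * P (Y @^-1` A))).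
  by rewrite !muleA -!EFinM -[LHS]mul1e; congr (_%:E * _); field; rewrite !lt0r_neq0.
by rewrite E !muleA -!EFinM; congr (_%:E * _); field; rewrite !lt0r_neq0.
Qed.

Lemma hpd_coverage (k : ('I_n -> R * R) -> R) (p : \bar R) :
  measurable_fun setT (fun s => k (fun i => X i s)) ->
  (forall x, proper_posterior prior x ->
    posterior_prob psi prior x (hpd_set psi prior x (k x)) = p) ->
  P [set s | hpd_set psi prior (fun i => X i s) (k (fun i => X i s))
       (interest_val psi w)] = p.
Proof.
move=> mk' hk.
have [Q0 Qoo law] := pivot_law_normalized.
have rw : interest_range psi (interest_val psi w).
  by rewrite /w; case: (psi) => //=; rewrite in_itv/= andbT; [exact: mulr_gt0|exact: divr_gt0].
pose g (v : R) : \bar R := ((fine Q)^-1)%:E * mk v.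
have mg : measurable_fun setT g.
  by apply: mfun_eM; [exact: measurable_cst|exact: mfun_mk].
pose sc s := iscale psi (sc1 (X^~ s)) (sc2 (X^~ s)).
have msc : measurable_fun setT sc.
  have h1 := mfun_sc1 mX; have h2 := mfun_sc2 mX.
  by rewrite /sc; case: (psi) => /=; mfun.
pose kap s := (sc s * k (X^~ s))%R.
have mkap : measurable_fun setT kap by rewrite /kap; mfun.
have mgY : measurable_fun setT (g \o Y) by exact: (measurableT_comp mg mY).
have mE : measurable [set s | (kap s)%:E <= (g \o Y) s].
  rewrite -[X in measurable X]setTI; apply: measurable_lee => //.
  by apply: mfun_EFin.
have Nneg := negligible_degenerate mw w0 iidX n3.
rewrite -(@superlevel_random_cutoff _ _ _ P (g \o Y) kap _ p mgY Nneg _ _ mE); first last.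
- move=> s /= /contrapT ns.
  rewrite -(hk _ (proper_nondeg n0 c0 Q0 Qoo ns)).
  rewrite (posterior_prob_hpd n0 c0 Q0 Qoo _ ns).
  have mA : measurable [set u : R | (kap s)%:E <= g u].
    rewrite -[X in measurable X]setTI.
    exact: (emeasurable_fun_c_infty measurableT mg).
  exact: (law _ mA).
- move=> NT; have := Nneg; rewrite NT => /(negligibleP P measurableT).
  move=> PT; have := probability_setT P; rewrite PT => /esym/eqP.
  by rewrite onee_eq0.
have ipX : measurable_fun setT (fun s => imarg psi (post c (X^~ s)) (interest_val psi w)).
  by case: (psi) => /=; do 4 (apply: mfun_int => [|*];
    last by do ?[apply: integral_ge0 => *]; exact: post_ge0);
    apply: mfun_post; try (move=> i; have mi := mX i); mfun.
have evX : measurable_fun setT (fun s => evidence prior (X^~ s)).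
  rewrite (_ : (fun _ => _) = (fun s => int5 (post c (X^~ s)))); last first.
    by apply/funext => s; exact: evidenceE.
  do 5 (apply: mfun_int => [|*]; last by do ?[apply: integral_ge0 => *]; exact: post_ge0).
  by apply: mfun_post; try (move=> i; have mi := mX i); mfun.
have HE : [set s | hpd_set psi prior (fun i => X i s) (k (fun i => X i s)) (interest_val psi w)] =
   [set s | (k (X^~ s))%:E <= ((fine (evidence prior (X^~ s)))^-1)%:E *
      imarg psi (post c (X^~ s)) (interest_val psi w)].
  apply/seteqP; split => s /=; rewrite /hpd_set/=.
    by move=> [_]; rewrite (marginal_densityE c0 _ rw).
  by move=> h; split => //; rewrite (marginal_densityE c0 _ rw).
have eqv s : nondeg (X^~ s) -> ((k (X^~ s))%:E <= ((fine (evidence prior (X^~ s)))^-1)%:E *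
      imarg psi (post c (X^~ s)) (interest_val psi w)) = ((kap s)%:E <= (g \o Y) s).
  move=> ns; have [x0 x1] := ns.
  have s0 : (0 < sc s)%R by rewrite iscale_gt0// sqrtr_gt0.
  have E : interest_val psi w = (iloc psi (slope (X^~ s)) + sc s * Y s)%R.
    rewrite /Y /pivot -/(sc s); move: (sc s) s0 (iloc _ _) (interest_val _ _) => q q0 l v.
    by field; rewrite lt0r_neq0.
  rewrite [X in imarg _ _ X]E (marginal_density_pivot n0 c0 Q0 Qoo _ ns).
  by rewrite lee_pdivlMl// -EFinM.
rewrite HE; apply: measure_eq_negligible => //.
- have mL : measurable_fun setT (fun s => (k (X^~ s))%:E) by exact: mfun_EFin.
  have mE' : measurable_fun setT (fun s => ((fine (evidence prior (X^~ s)))^-1)%:E).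
    apply: mfun_EFin; apply: measurable_fun_inv.
    exact: (measurableT_comp (fine_measurable measurableT) evX).
  rewrite -[X in measurable X]setTI.
  exact: (measurable_lee measurableT mL (mfun_eM mE' ipX)).
- by apply: negligibleS Nneg => s [/= h1 h2] ns; apply: h2; rewrite -eqv.
- by apply: negligibleS Nneg => s [/= h1 h2] ns; apply: h2; rewrite eqv.
Qed.

End coverage.

Theorem mainTheorem3 (R : realType) (c : R) (hc : 0 < c) (psi : interest) :
  hpd_matching (fun w : param R => c * (p_theta w * p_eta w)^-1) psi.
Proof.
move=> alpha k _ hk [m1 m2 b t e] [/= t0 e0].
have [] := sqrt_scales t0 e0.
(* Every valid theta and eta are the product and quotient of two positive scales, the form in which
   the group acts. *)
move: (Num.sqrt (t / e)) (Num.sqrt (t * e)) => a dd a0 d0 tE eE.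
rewrite -{}tE -{}eE {t e t0 e0} => d T P X iidX mk.
have exact_coverage n : (3 <= n)%N ->
    P n [set s | hpd_set psi (fun w : param R => c * (p_theta w * p_eta w)^-1)
      (fun i => X n i s) (k n (fun i => X n i s))
      (interest_val psi (Param m1 m2 b (a * dd) (dd / a)))] = (1 - alpha)%:E.
  move=> n3; apply: (hpd_coverage n3 a0 d0 hc (iidX n) (mk n)) => x.
  exact: hk.
apply/eqoP => eps eps0; near=> n.
rewrite exact_coverage /=; last by near: n; exact: nbhs_infty_ge.
by rewrite subrr normr0 mulr_ge0// ltW.
Unshelve. all: by end_near. Qed.
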